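(* Let $R$ be a Gorenstein Noetherian local ring. If $R$ satisfies $(\mathbf{ldep})$, then $R$ satisfies $(\mathbf{rdep})$.
   Context: All modules are finitely generated. $q_R(M,N):=\sup\{i\mid\operatorname{Tor}^R_i(M,N)\ne0\}$. $R$ satisfies $(\mathbf{ldep})$ (respectively $(\mathbf{rdep})$) if for all $R$-modules $M,N$ with $q_R(M,N)=0$ one has $\operatorname{depth}_R(M\otimes_R N)+\operatorname{depth}(R)\ge\operatorname{depth}_R(M)+\operatorname{depth}_R(N)$ (respectively $\le$). *)

(* Defs.v *)
From HB Require Import structures.
From mathcomp Require Import all_boot all_order all_algebra.
From mathcomp Require Import boolp classical_sets constructive_ereal.
From mathcomp Require Import freeg.

Set Implicit Arguments.
Unset Strict Implicit.
Unset Printing Implicit Defensive.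

Import Order.TTheory GRing.Theory Num.Theory.

Local Open Scope classical_set_scope.
Local Open Scope ring_scope.
Local Open Scope quotient_scope.

(** * Submodules, quotients and kernels *)

Definition submodule (R : comNzRingType) (V : lmodType R) (S : set V) : Prop :=
  submod_closed (mem S).

Definition lspan (R : comNzRingType) (V : lmodType R) (G : set V) : set V :=
  smallest (@submodule R V) G.

Definition fingen (R : comNzRingType) (M : lmodType R) : Prop :=
  exists s : seq M, lspan [set` s] = [set: M].

Definition nonzero (R : comNzRingType) (M : lmodType R) : Prop :=
  exists x : M, x != 0.

Lemma submoduleP (R : comNzRingType) (V : lmodType R) (S : set V) :
  submodule S <-> S 0 /\ forall a u v, S u -> S v -> S (a *: u + v).
Proof.
split=> -[S0 SL]; split.
- by move: S0; rewrite inE.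
- by move=> a u v Su Sv; move: (SL a u v); rewrite !inE; apply.
- by rewrite inE.
- by move=> a u v; rewrite !inE; apply: SL.
Qed.

Lemma lspan_submodule (R : comNzRingType) (V : lmodType R) (G : set V) :
  submodule (lspan G).
Proof.
apply/submoduleP; split=> [S [/submoduleP[S0 _] _] //|a u v Gu Gv S [SS GS]].
have [_ SL] := (submoduleP S).1 SS.
by apply: SL; [apply: Gu|apply: Gv].
Qed.

Lemma sub_lspan (R : comNzRingType) (V : lmodType R) (G : set V) :
  G `<=` lspan G.
Proof. exact: sub_smallest. Qed.

Lemma lspan_min (R : comNzRingType) (V : lmodType R) (G S : set V) :
  submodule S -> G `<=` S -> lspan G `<=` S.
Proof. by move=> SS GS x; apply. Qed.

Section Quotient.
Variables (R : comNzRingType) (V : lmodType R) (G : set V).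

Let sG : submodule (lspan G) := lspan_submodule G.

Lemma lspan0 : lspan G 0.
Proof. by have [] := (submoduleP _).1 sG. Qed.

Lemma lspanL a u v : lspan G u -> lspan G v -> lspan G (a *: u + v).
Proof. by have [_] := (submoduleP _).1 sG; apply. Qed.

Lemma lspanZ a u : lspan G u -> lspan G (a *: u).
Proof. by move=> Gu; rewrite -[_ *: _]addr0; exact: lspanL Gu lspan0. Qed.

Lemma lspanD u v : lspan G u -> lspan G v -> lspan G (u + v).
Proof. by move=> Gu Gv; rewrite -[u]scale1r; exact: lspanL. Qed.

Lemma lspanN u : lspan G u -> lspan G (- u).
Proof. by move=> Gu; rewrite -scaleN1r; exact: lspanZ. Qed.

Definition mod_equiv (x y : V) : bool := `[< lspan G (x - y) >].

Lemma mod_equiv_is_equiv : equiv_class_of mod_equiv.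
Proof.
split=> [x|x y|y x z].
- by apply/asboolP; rewrite subrr; exact: lspan0.
- by apply/asboolP/asboolP => /lspanN; rewrite opprB.
- move=> /asboolP xy /asboolP yz; apply/asboolP.
  by rewrite -[x](subrK y) -addrA; exact: lspanD.
Qed.

Canonical mod_equiv_equiv := EquivRelPack mod_equiv_is_equiv.
Canonical mod_equiv_encModRel := defaultEncModRel mod_equiv.

(** The quotient of [V] by the submodule generated by [G]. *)
Definition modquot : Type := {eq_quot mod_equiv}.

HB.instance Definition _ : EqQuotient V mod_equiv modquot :=
  EqQuotient.on modquot.
HB.instance Definition _ := Choice.on modquot.

Lemma modquotP (x y : V) : lspan G (x - y) <-> \pi_modquot x = \pi_modquot y.
Proof. by split=> [H|/eqmodP/asboolP//]; apply/eqmodP/asboolP. Qed.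

Definition modquot_zero : modquot := \pi_modquot 0.
Definition modquot_add (a b : modquot) : modquot :=
  \pi_modquot (repr a + repr b).
Definition modquot_opp (a : modquot) : modquot := \pi_modquot (- repr a).
Definition modquot_scale (c : R) (a : modquot) : modquot :=
  \pi_modquot (c *: repr a).

Definition modproj (x : V) : modquot := \pi_modquot x.

Lemma modproj_surj (a : modquot) : exists x, a = modproj x.
Proof. by exists (repr a); rewrite /modproj reprK. Qed.

Fact repr_modproj x : lspan G (repr (modproj x) - x).
Proof. by apply/modquotP; rewrite reprK. Qed.

Fact modquot_addE x y :
  modquot_add (modproj x) (modproj y) = modproj (x + y).
Proof.
apply/modquotP; rewrite opprD addrACA.
exact: lspanD (repr_modproj _) (repr_modproj _).
Qed.

Fact modquot_oppE x : modquot_opp (modproj x) = modproj (- x).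
Proof. by apply/modquotP; rewrite -opprD; exact: lspanN (repr_modproj _). Qed.

Fact modquot_scaleE c x : modquot_scale c (modproj x) = modproj (c *: x).
Proof.
by apply/modquotP; rewrite -scalerBr; exact: lspanZ (repr_modproj _).
Qed.

Fact modquot_addA : associative modquot_add.
Proof.
move=> a b c; have [x ->] := modproj_surj a.
have [[y ->] [z ->]] := (modproj_surj b, modproj_surj c).
by rewrite (modquot_addE y z) (modquot_addE x y) !modquot_addE addrA.
Qed.

Fact modquot_addC : commutative modquot_add.
Proof. by move=> a b; rewrite /modquot_add addrC. Qed.

Fact modquot_add0 : left_id modquot_zero modquot_add.
Proof.
by move=> a; have [x ->] := modproj_surj a; rewrite (modquot_addE 0 x) add0r.
Qed.

Fact modquot_addN : left_inverse modquot_zero modquot_opp modquot_add.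
Proof.
move=> a; have [x ->] := modproj_surj a.
by rewrite (modquot_oppE x) modquot_addE addNr.
Qed.

HB.instance Definition _ := GRing.isZmodule.Build modquot
  modquot_addA modquot_addC modquot_add0 modquot_addN.

Fact modquot_scaleA c d a :
  modquot_scale c (modquot_scale d a) = modquot_scale (c * d) a.
Proof.
have [x ->] := modproj_surj a.
by rewrite (modquot_scaleE d x) !modquot_scaleE scalerA.
Qed.

Fact modquot_scale1 : left_id 1 modquot_scale.
Proof.
by move=> a; have [x ->] := modproj_surj a; rewrite modquot_scaleE scale1r.
Qed.

Fact modquot_scaleDr : right_distributive modquot_scale +%R.
Proof.
move=> c a b; have [[x ->] [y ->]] := (modproj_surj a, modproj_surj b).
rewrite [modproj x + _](modquot_addE x y) !modquot_scaleE scalerDr.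
exact/esym/modquot_addE.
Qed.

Fact modquot_scaleDl a : {morph modquot_scale^~ a : c d / c + d}.
Proof.
move=> c d; have [x ->] := modproj_surj a.
rewrite !modquot_scaleE scalerDl; exact/esym/modquot_addE.
Qed.

HB.instance Definition _ := GRing.Zmodule_isLmodule.Build R modquot
  modquot_scaleA modquot_scale1 modquot_scaleDr modquot_scaleDl.

Fact modproj_is_linear : linear modproj.
Proof. by move=> a u v; rewrite -modquot_addE -modquot_scaleE. Qed.

HB.instance Definition _ :=
  GRing.isLinear.Build R V modquot _ modproj modproj_is_linear.

Lemma modproj_eq0 (x : V) : modproj x = 0 <-> lspan G x.
Proof.
have -> : (0 : modquot) = \pi_modquot 0 by [].
by rewrite -{2}[x]subr0; split=> /modquotP.
Qed.

End Quotient.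

Section QuotientMap.
Variables (R : comNzRingType) (V W : lmodType R) (G : set V) (H : set W).
Variables (f : {linear V -> W}) (fGH : forall x, G x -> lspan H (f x)).

Lemma lspan_map x : lspan G x -> lspan H (f x).
Proof.
apply: (@lspan_min _ _ _ [set x | lspan H (f x)]) => //.
apply/submoduleP; split=> [|a u v Hu Hv] /=; first by rewrite linear0; exact: lspan0.
by rewrite linearP; exact: lspanL.
Qed.

(** The map [V / <G> -> W / <H>] induced by [f]. *)
Definition modquot_map (a : modquot G) : modquot H := modproj H (f (repr a)).

Lemma modquot_mapE x : modquot_map (modproj G x) = modproj H (f x).
Proof.
apply/modquotP; rewrite -linearB; apply: lspan_map.
by apply/modquotP; rewrite reprK.
Qed.

Fact modquot_map_is_linear : linear modquot_map.
Proof.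
move=> c a b; have [[x ->] [y ->]] := (modproj_surj a, modproj_surj b).
by rewrite -linearP !modquot_mapE !linearP.
Qed.

End QuotientMap.

Arguments modquot_map {R V W G H} f a.

Section Kernel.
Variables (R : comNzRingType) (V W : lmodType R) (f : {linear V -> W}).

Definition ker_pred : {pred V} := fun x => f x == 0.

Fact ker_submod_closed : submod_closed ker_pred.
Proof.
split=> [|a u v]; rewrite !unfold_in /ker_pred ?linear0 //.
by move=> /eqP fu /eqP fv; rewrite linearP fu fv scaler0 addr0.
Qed.

HB.instance Definition _ :=
  GRing.isSubmodClosed.Build R V ker_pred ker_submod_closed.

Record ker : Type := Ker { ker_val : V ; _ : ker_val \in ker_pred }.

HB.instance Definition _ := [isSub for ker_val].
HB.instance Definition _ := [Choice of ker by <:].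
HB.instance Definition _ := [SubChoice_isSubLmodule of ker by <:].
End Kernel.

(** [ker g / im f], for [f : U -> V] and [g : V -> W]; when [g \o f = 0] the set
    that is divided out is already the submodule [im f]. *)
Definition homology (R : comNzRingType) (U V W : lmodType R)
    (f : {linear U -> V}) (g : {linear V -> W}) : lmodType R :=
  modquot [set z : ker g | range f (val z)].

(** * Tensor products and Tor *)

Section FreeLift.
Variables (R : comNzRingType) (K : choiceType) (M : lmodType R) (h : K -> M).

(** Linear extension of [h] to the free module with basis [K]. *)
Definition free_lift : {freeg K / R} -> M := fglift h.

Fact free_lift_is_linear : linear free_lift.
Proof.
have liftB : {morph free_lift : x y / x - y} := lift_is_additive h.
have lift0 : free_lift 0 = 0 by rewrite -(subrr 0) liftB subrr.
have liftD : {morph free_lift : x y / x + y}.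
  by move=> x y; rewrite -[y in LHS]opprK -[- y]sub0r !liftB lift0 sub0r opprK.
move=> a u v; rewrite liftD; congr (_ + _).
rewrite -[u in RHS]freeg_sumE !(big_morph free_lift liftD lift0) scaler_sumr.
by apply: eq_bigr => x _; rewrite /free_lift !liftU scalerA.
Qed.

HB.instance Definition _ :=
  GRing.isLinear.Build R {freeg K / R} M _ free_lift free_lift_is_linear.

Lemma free_liftU (x : K) : free_lift << x >> = h x.
Proof. by rewrite /free_lift liftU scale1r. Qed.
End FreeLift.

Section Tensor.
Variables (R : comNzRingType) (M N : lmodType R).

Definition tensor_pair (x : M) (y : N) : {freeg (M * N)%type / R} :=
  << (x, y) >>.

Local Notation b := tensor_pair.

Definition tensor_rel : set {freeg (M * N)%type / R} :=
  [set z | exists a x x' y, z = b (a *: x + x') y - a *: b x y - b x' y] `|`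
  [set z | exists a x y y', z = b x (a *: y + y') - a *: b x y - b x y'].

Definition tensor : lmodType R := modquot tensor_rel.

Definition tens (x : M) (y : N) : tensor := modproj tensor_rel (b x y).
End Tensor.

Section TensorMap.
Variables (R : comNzRingType) (M M' N : lmodType R) (f : {linear M -> M'}).

Definition tensor_gen (p : M * N) : {freeg (M' * N)%type / R} :=
  << (f p.1, p.2) >>.

Fact tensor_gen_rel z : tensor_rel z -> lspan (@tensor_rel R M' N)
  (free_lift tensor_gen z).
Proof.
case=> [[a [x [x' [y ->]]]]|[a [x [y [y' ->]]]]]; apply: sub_lspan.
- left; exists a, (f x), (f x'), y.
  by rewrite !linearB linearZ /= !free_liftU /tensor_gen /tensor_pair /= linearP.
- right; exists a, (f x), y, y'.
  by rewrite !linearB linearZ /= !free_liftU.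
Qed.

(** [f \otimes id_N] *)
Definition tensor_map : tensor M N -> tensor M' N :=
  modquot_map (free_lift tensor_gen).

HB.instance Definition _ := GRing.isLinear.Build R (tensor M N) (tensor M' N) _
  tensor_map (modquot_map_is_linear tensor_gen_rel).

Lemma tensor_mapE x y : tensor_map (tens x y) = tens (f x) y.
Proof.
rewrite /tensor_map /tens (modquot_mapE tensor_gen_rel).
by congr modproj; exact: free_liftU.
Qed.
End TensorMap.

Arguments tensor_map {R M M'} N f a.

Section Tor.
Variables (R : comNzRingType) (M : lmodType R).

(** The canonical free resolution of [M]: [free_res n] is the free module on the
    underlying set of the [n]-th syzygy of [M], and [res_diff n] is the composite
    [free_res n.+1 ->> syz n.+1 >-> free_res n]. *)
Definition free_cover (L : lmodType R) : {linear {freeg L / R} -> L} :=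
  free_lift (@id L).

Definition syz (n : nat) : lmodType R :=
  iter n (fun L : lmodType R => ker (free_cover L) : lmodType R) M.

Definition free_res (n : nat) : lmodType R := {freeg (syz n) / R}.

Definition res_diff (n : nat) : {linear free_res n.+1 -> free_res n} :=
  (val : ker (free_cover (syz n)) -> free_res n) \o free_cover (syz n.+1).

Definition Tor (i : nat) (N : lmodType R) : lmodType R :=
  match i with
  | 0 => homology (tensor_map N (res_diff 0))
           (\0 : {linear tensor (free_res 0) N -> tensor (free_res 0) N})
  | j.+1 => homology (tensor_map N (res_diff j.+1)) (tensor_map N (res_diff j))
  end.
End Tor.

(** [sup {i | Tor_i(M, N) <> 0}], equal to [-oo] if all [Tor_i(M, N)] vanish. *)
Definition q_Tor (R : comNzRingType) (M N : lmodType R) : \bar int :=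
  supremum -oo%E [set (i%:Z)%:E | i in [set i | nonzero (Tor M i N)]].

(** * Local rings, depth and the Gorenstein property *)

Definition ideal (R : comNzRingType) (I : set R) : Prop :=
  @submodule R R^o I.

Definition maximal_ideal (R : comNzRingType) (m : set R) : Prop :=
  [/\ ideal m, ~ m 1 &
      forall I : set R, ideal I -> ~ I 1 -> m `<=` I -> I = m].

Definition local_ring (R : comNzRingType) (m : set R) : Prop :=
  maximal_ideal m /\ forall m' : set R, maximal_ideal m' -> m' = m.

Definition noetherian (R : comNzRingType) : Prop :=
  forall I : set R, ideal I -> exists s : seq R, I = @lspan R R^o [set` s].

(** Generators of [(s) M]. *)
Definition smul_gens (R : comNzRingType) (M : lmodType R) (s : seq R) : set M :=
  [set z | exists2 a, a \in s & exists v : M, z = a *: v].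

Arguments smul_gens {R} M s.

Definition regular_seq (R : comNzRingType) (M : lmodType R) (s : seq R) : Prop :=
  (forall i, (i < size s)%N ->
     forall z : modquot (smul_gens M (take i s)), s`_i *: z = 0 -> z = 0) /\
  nonzero (modquot (smul_gens M s)).

(** Supremum of the lengths of the [M]-regular sequences in [m], with
    [depth 0 = +oo]. *)
Definition depth (R : comNzRingType) (m : set R) (M : lmodType R) : \bar int :=
  if `[< nonzero M >] then
    supremum -oo%E [set ((size s)%:Z)%:E | s in
      [set s : seq R | [set` s] `<=` m /\ regular_seq M s]]
  else +oo%E.

Definition injective_module (R : comNzRingType) (E : lmodType R) : Prop :=
  forall (A B : lmodType R) (i : {linear A -> B}) (f : {linear A -> E}),
    injective i -> exists g : {linear B -> E}, forall x, g (i x) = f x.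

(** There is an exact sequence [0 -> M -> I 0 -> ... -> I n -> 0] with all the
    [I k] injective. *)
Definition finite_injdim (R : comNzRingType) (M : lmodType R) : Prop :=
  exists (n : nat) (I : nat -> lmodType R) (e : {linear M -> I 0})
         (d : forall k, {linear I k -> I k.+1}),
    [/\ forall k, injective_module (I k),
        injective e,
        range e = [set x | d 0 x = 0],
        forall k, range (d k) = [set x | d k.+1 x = 0] &
        forall k, (n < k)%N -> ~ nonzero (I k)].

Definition gorenstein_local (R : comNzRingType) (m : set R) : Prop :=
  [/\ noetherian R, local_ring m & finite_injdim (R^o : lmodType R)].

(** * The two depth inequalities *)

Definition ldep (R : comNzRingType) (m : set R) : Prop :=
  forall M N : lmodType R, fingen M -> fingen N -> q_Tor M N = 0%E ->
    (depth m M + depth m N <= depth m (tensor M N) + depth m R^o)%E.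

Definition rdep (R : comNzRingType) (m : set R) : Prop :=
  forall M N : lmodType R, fingen M -> fingen N -> q_Tor M N = 0%E ->
    (depth m (tensor M N) + depth m R^o <= depth m M + depth m N)%E.

(* Main.v *)
(* Write d for the depth of R, M ox N for the tensor product, and call M and N
   Tor-independent if Tor_i(M, N) = 0 for all i > 0.  Over a Gorenstein ring a
   finitely generated module X <> 0 has depth d iff Ext^i(X, R) = 0 for i > 0, and then
   X embeds in a finite free module with a cokernel C of depth d.  The key point is
   that for d > 0, under (ldep), Tor-independence of X and N passes to C and N.  If
   N also has depth d, let x in m be R-regular and let E be the pushout of X -> R^g
   along x : X -> X; E has depth d and is Tor-independent from N, so x is regular on
   E ox N, although x kills the image in it of T = Tor_1(C, N).  Hence T = x T = 0.
   The case of arbitrary N follows by replacing N by its d-th syzygy and X by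
   iterated cokernels.

   Suppose now that depth(M ox N) + d > depth M + depth N.  Replacing M by syzygies
   reduces the case depth M < d to depth M = d - 1 and depth(M ox N) >= depth N.
   Choose 0 -> G -> E -> M -> 0 with G free and E of depth d, embed E in a free
   module G', and let P = G'/G.  Then M ox N -> P ox N has the cokernel
   (G'/E) ox N, so P ox N has depth at least depth N =: b, and G ox N -> G' ox N is
   injective on Ext^b(k, -).  So G -> G' is injective modulo m, hence split, and M
   is a direct summand of E, which contradicts depth M = d - 1.  If depth M = d >
   depth N, exchange M and N; if both depths are d, then depth(M ox N) > d is
   impossible. *)

Require Import Defs.
From HB Require Import structures.
From mathcomp Require Import all_boot all_order all_algebra.
From mathcomp Require Import boolp classical_sets constructive_ereal functions.
From mathcomp Require Import freeg.

Set Implicit Arguments.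
Unset Strict Implicit.
Unset Printing Implicit Defensive.

Import Order.TTheory GRing.Theory Num.Theory.

Local Open Scope classical_set_scope.
Local Open Scope ring_scope.

(** * Linear maps and short exact sequences *)

Section LinearMaps.
Variable R : comNzRingType.
Implicit Types A B C D E F G K L M N P U V W : lmodType R.

(** The Gorenstein property is given as a finite injective resolution of R and depth through regular
    sequences; both are traded for vanishing conditions. Depth becomes the vanishing of Ext^i(k, -),
    computed with one fixed free resolution of the residue field k, and Tor-independence is computed
    with a fixed free resolution of N. Resolutions are sequences of matrices, so the same diagram
    chases serve both functors. The length of the injective resolution need not be d and must first
    be lowered to d; only then does depth d amount to the vanishing of Ext^i(-, R) for i > 0. In the
    pushout argument (ldep) acts twice: it makes x regular on X ox N, which gives Tor_1(E, N) = 0,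
    and then on E ox N. That argument needs an R-regular x in m, hence d > 0; for d = 0 all depths
    of nonzero modules are 0. *)

Definition linmap A B (f : A -> B) (lf : linear f) : {linear A -> B} :=
  HB.pack f (GRing.isLinear.Build R A B _ f lf).

Lemma lin_factor A B W (p : {linear A -> B}) (f : {linear A -> W}) :
  (forall b, exists a, b = p a) -> (forall a, p a = 0 -> f a = 0) ->
  exists g : {linear B -> W}, forall a, g (p a) = f a.
Proof.
move=> /choice[s sP] fker.
have gE a : f (s (p a)) = f a.
  by apply/eqP; rewrite -subr_eq0 -linearB fker // linearB -sP subrr.
have lg : linear (f \o s).
  by move=> a u v /=; rewrite {1}(sP u) {1}(sP v) -linearP gE linearP.
by exists (linmap lg).
Qed.

Lemma lin_lift A B W (i : {linear A -> B}) (f : {linear W -> B}) :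
  injective i -> (forall w, exists a, f w = i a) ->
  exists g : {linear W -> A}, forall w, i (g w) = f w.
Proof.
move=> inj /choice[s sP].
have ls : linear s by move=> a u v; apply: inj; rewrite -sP !linearP !sP.
by exists (linmap ls).
Qed.

Definition ses A B C (i : {linear A -> B}) (p : {linear B -> C}) : Prop :=
  [/\ injective i, forall b, p b = 0 <-> exists a, b = i a &
      forall c, exists b, c = p b].

Lemma lin_inj A B (i : {linear A -> B}) :
  (forall x, i x = 0 -> x = 0) -> injective i.
Proof.
move=> i0 x y xy; apply/eqP; rewrite -subr_eq0; apply/eqP/i0.
by rewrite linearB xy subrr.
Qed.

Lemma lin_inj0 A B (i : {linear A -> B}) x : injective i -> i x = 0 -> x = 0.
Proof. by move=> inj ix; apply: inj; rewrite linear0. Qed.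

Lemma ses_comp0 A B C (i : {linear A -> B}) (p : {linear B -> C}) a :
  ses i p -> p (i a) = 0.
Proof. by case=> _ ex _; apply/ex; exists a. Qed.

Lemma lspanE (V : lmodType R) (S : set V) : submodule S -> lspan S = S.
Proof.
by move=> SS; apply/seteqP; split; [apply: lspan_min|apply: sub_lspan].
Qed.

Lemma modproj_eq0E (V : lmodType R) (S : set V) x :
  submodule S -> modproj S x = 0 <-> S x.
Proof. by move=> SS; rewrite modproj_eq0 lspanE. Qed.

Lemma range_submodule A B (f : {linear A -> B}) : submodule (range f).
Proof.
apply/submoduleP; split; first by exists 0; rewrite ?linear0.
by move=> a _ _ [u _ <-] [v _ <-]; exists (a *: u + v); rewrite ?linearP.
Qed.

Lemma coker_exact A B (f : {linear A -> B}) b :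
  modproj (range f) b = 0 <-> exists a, b = f a.
Proof.
rewrite modproj_eq0E; last exact: range_submodule.
by split=> [[a _ <-]|[a ->]]; exists a.
Qed.

Lemma coker_ses A B (f : {linear A -> B}) :
  injective f -> ses f (modproj (range f)).
Proof.
by move=> inj; split=> //; [apply: coker_exact|apply: modproj_surj].
Qed.

Lemma ker_ses B C (p : {linear B -> C}) : (forall c, exists b, c = p b) ->
  ses (val : ker p -> B) p.
Proof.
move=> ps; split; [exact: (@val_inj _ _ (ker p))| |done].
move=> b; split=> [pb|[a ->]]; last by apply/eqP; exact: (valP a).
have bk : b \in ker_pred p by apply/eqP.
by exists (Ker bk).
Qed.

(** The third isomorphism theorem: P is C / A, which contains M = B / A with quotient D = C / B. *)
Lemma ses_comp A B C M D (g : {linear A -> B}) (p : {linear B -> M})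
    (i : {linear B -> C}) (q : {linear C -> D}) :
  ses g p -> ses i q ->
  exists (P : lmodType R) (c : {linear C -> P}) (u : {linear M -> P})
    (v : {linear P -> D}), ses (i \o g : {linear A -> C}) c /\ ses u v.
Proof.
move=> gp iq; have [ginj gex psurj] := gp; have [iinj iex qsurj] := iq.
pose f : {linear A -> C} := i \o g.
have finj : injective f by exact: inj_comp.
have fc := coker_ses finj; have [_ cex csurj] := fc.
set c : {linear C -> _} := modproj (range f) in fc cex csurj *.
have [u uE] : exists u : {linear M -> modquot (range f)},
    forall b, u (p b) = (c \o i) b.
  by apply: lin_factor => // b /gex[a ->]; apply/cex; exists a.
have [v vE] : exists v : {linear modquot (range f) -> D},
    forall x, v (c x) = q x.
  by apply: lin_factor => // x /cex[a ->]; apply/iex; exists (g a).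
exists (modquot (range f)), c, u, v; split=> //; split.
- apply: lin_inj => m; have [b ->] := psurj m.
  by rewrite uE /= => /cex[a /iinj ->]; apply/gex; exists a.
- move=> y; have [x ->] := csurj y; rewrite vE iex; split=> [[b ->]|[m]].
    by exists (p b); rewrite uE.
  have [b ->] := psurj m; rewrite uE /= => /eqP; rewrite -subr_eq0 -linearB.
  move=> /eqP/cex[a /eqP]; rewrite subr_eq => /eqP ->.
  by exists (g a + b); rewrite linearD.
- by move=> d; have [x ->] := qsurj d; exists (c x); rewrite vE.
Qed.

Definition pairmap W A B (f : {linear W -> A}) (g : {linear W -> B}) w :=
  (f w, g w).

Fact pairmap_linear W A B (f : {linear W -> A}) (g : {linear W -> B}) :
  linear (pairmap f g).
Proof. by move=> a u v; rewrite /pairmap !linearP. Qed.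

(** The presentation of E by s and t is kept beside the two extensions: after tensoring, it yields
    Tor of E and decides which elements coming from F vanish in E. *)
Lemma pushout L F G M C (i : {linear L -> F}) (p : {linear F -> M})
    (j : {linear L -> G}) (q : {linear G -> C}) :
  ses i p -> ses j q ->
  exists (E : lmodType R) (a : {linear F -> E}) (b : {linear G -> E})
    (c : {linear E -> M}) (d : {linear E -> C})
    (s : {linear L -> (F * G)%type}) (t : {linear (F * G)%type -> E}),
    [/\ ses b c, ses a d, ses s t, forall x, a (i x) = b (j x) &
        [/\ forall x, s x = (i x, - j x), forall x, t (x, 0) = a x &
            forall y, t (0, y) = b y]].
Proof.
move=> ip jq; have [iinj iex psurj] := ip; have [jinj jex qsurj] := jq.
pose s := linmap (pairmap_linear i (\- j : {linear _ -> _})).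
have sE x : s x = (i x, - j x) by [].
have sinj : injective s by move=> x y [/iinj].
have st := coker_ses sinj; have [_ tex tsurj] := st.
set t : {linear (F * G)%type -> _} := modproj (range s) in st tex tsurj *.
have la : linear (fun x => t (x, 0)).
  by move=> k x y; rewrite -linearP; congr (t (_, _)); rewrite /= scaler0 addr0.
have lb : linear (fun y => t (0, y)).
  by move=> k x y; rewrite -linearP; congr (t (_, _)); rewrite /= scaler0 addr0.
have [a aE] : exists a : {linear F -> _}, forall x, t (x, 0) = a x.
  by exists (linmap la).
have [b bE] : exists b : {linear G -> _}, forall y, t (0, y) = b y.
  by exists (linmap lb).
have tE z : t z = a z.1 + b z.2.
  by rewrite -aE -bE -linearD; congr (t _); case: z => x y; congr pair; rewrite /= ?addr0 ?add0r.
have [c cE] : exists c : {linear modquot (range s) -> M},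
    forall z, c (t z) = (p \o fst) z.
  by apply: lin_factor => // z /tex[x ->]; apply/iex; exists x.
have [d dE] : exists d : {linear modquot (range s) -> C},
    forall z, d (t z) = (q \o snd) z.
  by apply: lin_factor => // z /tex[x ->] /=; rewrite linearN (ses_comp0 _ jq) oppr0.
have ab x : a (i x) = b (j x).
  apply/eqP; rewrite -subr_eq0 -linearN -aE -bE -linearD; apply/eqP/tex; exists x.
  by rewrite sE; congr pair; rewrite /= ?addr0 ?add0r.
exists (modquot (range s)), a, b, c, d, s, t; split=> //; split.
- apply: lin_inj => y; rewrite -bE => /tex[x [/esym/(lin_inj0 iinj) -> ->]].
  by rewrite linear0 oppr0.
- move=> z; have [[x y] ->] := tsurj z; rewrite cE /= iex; split=> [[l ->]|[y']].
    by exists (j l + y); rewrite tE /= ab linearD.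
  rewrite -bE => /eqP; rewrite -subr_eq0 -linearB => /eqP/tex[l [/eqP]].
  by rewrite subr0 => /eqP -> _; exists l.
- by move=> m; have [x ->] := psurj m; exists (a x); rewrite -aE cE.
- apply: lin_inj => y; rewrite -aE => /tex[x [-> /eqP]].
  by rewrite eq_sym oppr_eq0 => /eqP/(lin_inj0 jinj) ->; rewrite linear0.
- move=> z; have [[x y] ->] := tsurj z; rewrite dE /= jex; split=> [[l ->]|[x']].
    by exists (x + i l); rewrite tE /= -ab linearD.
  rewrite -aE => /eqP; rewrite -subr_eq0 -linearB => /eqP/tex[l [_ /eqP]].
  by rewrite subr0 => /eqP ->; exists (- l); rewrite linearN.
- by move=> m; have [x ->] := qsurj m; exists (b x); rewrite -bE dE.
Qed.

(** ** Finite generation *)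

Definition spans (M : lmodType R) n (g : 'I_n -> M) (S : set M) : Prop :=
  (forall j, S (g j)) /\
  forall x, S x -> exists u : 'I_n -> R, x = \sum_j u j *: g j.

Definition fg (M : lmodType R) : Prop := exists n (g : 'I_n -> M), spans g setT.

Definition noeth (M : lmodType R) : Prop :=
  forall S : set M, submodule S -> exists n (g : 'I_n -> M), spans g S.

Lemma submodule_sum (M : lmodType R) (S : set M) I (r : seq I) (u : I -> R)
    (g : I -> M) :
  submodule S -> (forall j, S (g j)) -> S (\sum_(j <- r) u j *: g j).
Proof.
move=> /submoduleP[S0 SL] Sg; elim/big_rec: _ => // j x _ Sx; exact: SL.
Qed.

Lemma noeth_fg M : noeth M -> fg M.
Proof.
by move=> nM; have [|n [g gM]] := nM setT; [exact/submoduleP|exists n, g].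
Qed.

Lemma lspan_seq (M : lmodType R) (s : seq M) x : lspan [set` s] x ->
  exists u : 'I_(size s) -> R, x = \sum_j u j *: s`_j.
Proof.
move: x; apply: (@lspan_min R M [set` s]
  [set x | exists u : 'I_(size s) -> R, x = \sum_j u j *: s`_j]).
  apply/submoduleP; split.
    by exists (fun=> 0); rewrite big1 // => j _; rewrite scale0r.
  move=> a _ _ [u ->] [v ->]; exists (fun j => a * u j + v j).
  rewrite scaler_sumr -big_split /=; apply: eq_bigr => j _.
  by rewrite scalerDl scalerA.
move=> y /= ys; have lt : (index y s < size s)%N by rewrite index_mem.
exists (fun j => (j == Ordinal lt)%:R).
rewrite (bigD1 (Ordinal lt)) //= eqxx scale1r nth_index // big1 ?addr0 //.
by move=> j /negPf ->; rewrite scale0r.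
Qed.

Lemma spans_seq (M : lmodType R) n (g : 'I_n -> M) (S : set M) :
  submodule S -> spans g S -> S = lspan [set` codom g].
Proof.
move=> SS [Sg gS]; apply/seteqP; split=> [x /gS[u ->]|].
  apply: (submodule_sum _ _ (@lspan_submodule _ _ [set` codom g])).
  by move=> j; apply: sub_lspan; exact: codom_f.
by apply: lspan_min => // y /= /codomP[j ->].
Qed.

Lemma fgP M : fg M <-> fingen M.
Proof.
split=> [[n [g gM]]|[s sM]].
  by exists (codom g); rewrite -(spans_seq _ gM) //; apply/submoduleP.
exists (size s), (fun j => s`_j); split=> // x _; apply: lspan_seq.
by rewrite sM.
Qed.

Lemma fg_surj A B (p : {linear A -> B}) :
  (forall b, exists a, b = p a) -> fg A -> fg B.
Proof.
move=> ps [n [g [_ gA]]]; exists n, (p \o g); split=> // b _.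
have [a ->] := ps b; have [u ->] := gA a I; exists u.
by rewrite linear_sum; apply: eq_bigr => j _; rewrite linearZ.
Qed.

Lemma fg_ses A B C (i : {linear A -> B}) (p : {linear B -> C}) :
  ses i p -> fg A -> fg C -> fg B.
Proof.
move=> [_ ex ps] [n [g [_ gA]]] [n' [h [_ hC]]].
have /choice[k kE] := fun j => ps (h j).
exists (n + n')%N, (fun j => match fintype.split j with inl a => i (g a) | inr b => k b end).
split=> // b _; have [v vE] := hC (p b) I.
have [a aE] : exists a, b - \sum_j v j *: k j = i a.
  apply/ex; rewrite linearB vE linear_sum; apply/eqP; rewrite subr_eq0; apply/eqP.
  by apply: eq_bigr => j _; rewrite linearZ /= -kE.
have [u uE] := gA a I.
exists (fun j => match fintype.split j with inl a => u a | inr b => v b end).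
rewrite big_split_ord /=.
under eq_bigr do rewrite (unsplitK (inl _)).
under [X in _ + X]eq_bigr do rewrite (unsplitK (inr _)).
rewrite -[b in LHS](subrK (\sum_j v j *: k j)) aE uE linear_sum.
by congr (_ + _); apply: eq_bigr => j _; rewrite linearZ.
Qed.

Lemma noeth_surj A B (p : {linear A -> B}) :
  (forall b, exists a, b = p a) -> noeth A -> noeth B.
Proof.
move=> ps nA S /submoduleP[S0 SL].
have [|n [g [Sg gS]]] := nA (p @^-1` S).
  by apply/submoduleP; split=> [|a u v Su Sv] /=; rewrite ?linear0 ?linearP //; exact: SL.
exists n, (p \o g); split=> [j|b Sb]; first exact: Sg.
have [a aE] := ps b; have [|u uE] := gS a; first by rewrite /= -aE.
exists u; rewrite aE uE linear_sum.
by apply: eq_bigr => j _; rewrite linearZ.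
Qed.

Lemma noeth_ses A B C (i : {linear A -> B}) (p : {linear B -> C}) :
  ses i p -> noeth A -> noeth C -> noeth B.
Proof.
move=> [_ ex ps] nA nC S SS; have [S0 SL] := (submoduleP S).1 SS.
have [|n [g [Sg gS]]] := nA (i @^-1` S).
  by apply/submoduleP; split=> [|a u v Su Sv] /=; rewrite ?linear0 ?linearP //; exact: SL.
have [|n' [h [Sh hS]]] := nC (p @` S).
  apply/submoduleP; split=> [|a _ _ [u Su <-] [v Sv <-]].
    by exists 0; rewrite ?linear0.
  by exists (a *: u + v); rewrite ?linearP //; exact: SL.
have /choice[k kE] : forall j, exists b, S b /\ p b = h j.
  by move=> j; have [b] := Sh j; exists b.
exists (n + n')%N, (fun j => match fintype.split j with inl a => i (g a) | inr b => k b end).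
split=> [j|b Sb].
  by case: fintype.split => j'; [exact: Sg|exact: (kE j').1].
have [|v vE] := hS (p b); first by exists b.
have [a aE] : exists a, b - \sum_j v j *: k j = i a.
  apply/ex; rewrite linearB vE linear_sum; apply/eqP; rewrite subr_eq0; apply/eqP.
  by apply: eq_bigr => j _; rewrite linearZ /= (kE j).2.
have [|u uE] := gS a.
  rewrite /= -aE addrC -scaleN1r; apply: SL => //.
  by apply: (submodule_sum _ _ SS) => j; exact: (kE j).1.
exists (fun j => match fintype.split j with inl a => u a | inr b => v b end).
rewrite big_split_ord /=.
under eq_bigr do rewrite (unsplitK (inl _)).
under [X in _ + X]eq_bigr do rewrite (unsplitK (inr _)).
rewrite -[b in LHS](subrK (\sum_j v j *: k j)) aE uE linear_sum.
by congr (_ + _); apply: eq_bigr => j _; rewrite linearZ.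
Qed.

Lemma noeth_sub A B (i : {linear A -> B}) : injective i -> noeth B -> noeth A.
Proof.
move=> inj nB S /submoduleP[S0 SL]; have [|n [g [Sg gS]]] := nB (i @` S).
  apply/submoduleP; split=> [|a _ _ [u Su <-] [v Sv <-]].
    by exists 0; rewrite ?linear0.
  by exists (a *: u + v); rewrite ?linearP //; exact: SL.
have /choice[k kE] : forall j, exists b, S b /\ i b = g j.
  by move=> j; have [b] := Sg j; exists b.
exists n, k; split=> [j|x Sx]; first exact: (kE j).1.
have [|u uE] := gS (i x); first by exists x.
exists u; apply: inj; rewrite uE linear_sum.
by apply: eq_bigr => j _; rewrite linearZ /= (kE j).2.
Qed.

Definition rVlift (M : lmodType R) n (g : 'I_n -> M) (u : 'rV[R]_n) : M :=
  \sum_j u 0 j *: g j.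

Fact rVlift_linear (M : lmodType R) n (g : 'I_n -> M) : linear (rVlift g).
Proof.
move=> a u v; rewrite /rVlift scaler_sumr -big_split /=; apply: eq_bigr => j _.
by rewrite !mxE scalerDl scalerA.
Qed.
HB.instance Definition _ (M : lmodType R) n (g : 'I_n -> M) :=
  GRing.isLinear.Build R 'rV[R]_n M _ (rVlift g) (rVlift_linear g).

Lemma rV_linE (M : lmodType R) n (f : {linear 'rV[R]_n -> M}) u :
  f u = \sum_j u 0 j *: f (delta_mx 0 j).
Proof.
by rewrite {1}[u]row_sum_delta linear_sum; apply: eq_bigr => j _; rewrite linearZ.
Qed.

Lemma fg_rVP M : fg M <->
  exists n (f : {linear 'rV[R]_n -> M}), forall x, exists u, x = f u.
Proof.
split=> [[n [g [_ gM]]]|[n [f fs]]].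
  exists n, (rVlift g : {linear _ -> _}) => x; have [u ->] := gM x I.
  by exists (\row_j u j); rewrite /= /rVlift; apply: eq_bigr => j _; rewrite mxE.
exists n, (fun j => f (delta_mx 0 j)); split=> // x _; have [u ->] := fs x.
by exists (u 0); exact: rV_linE.
Qed.

Lemma fg_rV n : fg ('rV[R]_n : lmodType R).
Proof. by apply/fg_rVP; exists n, (idfun : {linear _ -> _}) => x; exists x. Qed.

End LinearMaps.

(** * Noetherian rings and free resolutions *)

Section Noetherian.
Variables (R : comNzRingType) (nR : noetherian R).
Implicit Types A B C M N W : lmodType R.

Lemma noeth_ring : noeth (R^o : lmodType R).
Proof.
move=> I /nR[s sI]; exists (size s), (fun j => s`_j); split=> [j|x].
  by rewrite sI; apply: sub_lspan; exact: mem_nth.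
by rewrite sI => /lspan_seq.
Qed.

Definition rV_head n (u : 'rV[R]_n.+1) : 'rV[R]_n := \row_j u 0 (fintype.lift ord0 j).

Fact rV_head_linear n : linear (@rV_head n).
Proof. by move=> a u v; apply/rowP => j; rewrite !mxE. Qed.

Fact rV_line_linear n : linear (fun a : R^o => a *: delta_mx 0 0 : 'rV[R]_n.+1).
Proof. by move=> a u v; rewrite scalerDl scalerA. Qed.

Lemma rV_ses n : ses (linmap (@rV_line_linear n)) (linmap (@rV_head_linear n)).
Proof.
split=> /=.
- apply: (@lin_inj _ _ _ (linmap (@rV_line_linear n))) => x /= /rowP/(_ 0).
  by rewrite !mxE /= mulr1.
- move=> u; split=> [/rowP u0|[a ->]]; last first.
    by apply/rowP => j; rewrite !mxE mulr0.
  exists (u 0 0); apply/rowP => j; rewrite !mxE /=.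
  case: (unliftP ord0 j) => [k ->|->]; last by rewrite mulr1.
  by move: (u0 k); rewrite !mxE => ->; rewrite mulr0.
- move=> v; exists (\row_j if fintype.unlift ord0 j is Some k then v 0 k else 0).
  by apply/rowP => j; rewrite !mxE liftK.
Qed.

Lemma noeth_rV n : noeth ('rV[R]_n : lmodType R).
Proof.
elim: n => [|n IH]; last exact: noeth_ses (rV_ses n) noeth_ring IH.
move=> S /submoduleP[S0 _]; exists 0%N, (fun=> 0); split=> [//|x _].
by exists (fun=> 0); rewrite big_ord0; apply/rowP => -[].
Qed.

Lemma fg_noeth M : fg M -> noeth M.
Proof. by move=> /fg_rVP[n [f fs]]; exact: noeth_surj fs (@noeth_rV n). Qed.

Lemma fg_sub A B (i : {linear A -> B}) : injective i -> fg B -> fg A.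
Proof. by move=> inj fB; apply: noeth_fg; apply: noeth_sub inj _; exact: fg_noeth. Qed.

Lemma prod_ses A B : exists i : {linear A -> (A * B)%type},
  (forall a, i a = (a, 0)) /\ ses i (snd : {linear (A * B)%type -> B}).
Proof.
have li : linear (fun a : A => (a, 0 : B)).
  by move=> a u v; congr pair; rewrite /= scaler0 addr0.
exists (linmap li); split=> //; split.
- by move=> x y [].
- by move=> [a b]; split=> [/= ->|[x [_ ->]//]]; exists a.
- by move=> b; exists (0, b).
Qed.

(** Otherwise choice yields a strictly increasing chain of submodules satisfying P, whose union is
    finitely generated and so lies in one of its members. *)
Lemma max_submodule M (P : set M -> Prop) (U0 : set M) :
  fg M -> submodule U0 -> P U0 ->
  exists U, [/\ submodule U, P U &
    forall V, submodule V -> P V -> U `<=` V -> V `<=` U].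
Proof.
move=> /fg_noeth nM sU0 PU0; apply: contrapT => nmax.
have step (U : {U : set M | submodule U /\ P U}) :
    exists V : {U : set M | submodule U /\ P U},
      sval U `<=` sval V /\ ~ sval V `<=` sval U.
  case: U => U [sU PU]; apply: contrapT => nV; apply: nmax; exists U; split=> //.
  move=> V sV PV UV; apply: contrapT => nVU; apply: nV.
  by exists (exist _ V (conj sV PV)).
have /choice[f fP] := step.
pose u n := sval (iter n f (exist _ U0 (conj sU0 PU0))).
have su n : submodule (u n) by have [] := svalP (iter n f (exist _ U0 (conj sU0 PU0))).
have ule n k : u n `<=` u (n + k)%N.
  elim: k => [|k IH]; first by rewrite addn0.
  by rewrite addnS => x /IH; have [+ _] := fP (iter (n + k) f (exist _ U0 (conj sU0 PU0))); apply.
have sU : submodule [set x | exists n, u n x].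
  apply/submoduleP; split; first by exists 0%N; case/submoduleP: (su 0%N).
  move=> a x y [n ux] [k uy]; exists (n + k)%N.
  have [_] := (submoduleP _).1 (su (n + k)%N); apply; first exact: ule ux.
  by rewrite addnC; exact: ule uy.
have [n [g [/choice[k kP] gU]]] := nM _ sU.
(* The sum of the stages at which the generators appear bounds each of them. *)
pose N := (\sum_j k j)%N.
have gN j : u N (g j).
  by rewrite /N (bigD1 j) //=; exact: ule (kP j).
have [_] := fP (iter N f (exist _ U0 (conj sU0 PU0))); apply.
move=> x uSx; have [|c ->] := gU x; first by exists N.+1.
exact: (submodule_sum _ _ (su N)).
Qed.

Lemma fg_rows n (S : set 'rV[R]_n) : submodule S ->
  exists k (A : 'M[R]_(k, n)), forall u, S u <-> exists w, u = w *m A.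
Proof.
move=> sS; have [k [g [Sg gS]]] := noeth_rV sS.
exists k, (\matrix_j g j) => u; split=> [/gS[c ->]|[w ->]].
  exists (\row_j c j); rewrite mulmx_sum_row; apply: eq_bigr => j _.
  by rewrite mxE rowK.
rewrite mulmx_sum_row; apply: (submodule_sum _ _ sS) => j.
by rewrite rowK.
Qed.

End Noetherian.

(** Matrices act on row vectors from the right: [dmx i] is the differential from degree i + 1 to
    degree i. *)
Record fres (R : comNzRingType) (K : lmodType R) : Type := Fres {
  rk : nat -> nat;
  dmx : forall i, 'M[R]_(rk i.+1, rk i);
  aug : {linear 'rV[R]_(rk 0) -> K};
  aug_surj : forall z, exists u, z = aug u;
  aug_ker : forall u, aug u = 0 <-> exists w, u = w *m dmx 0;
  dmx_exact : forall i (u : 'rV[R]_(rk i.+1)), u *m dmx i = 0 <-> exists w, u = w *m dmx i.+1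
}.

Section Resolution.
Variables (R : comNzRingType) (nR : noetherian R).

Lemma syzygy_rows p q (A : 'M[R]_(p, q)) :
  exists r (B : 'M[R]_(r, p)), forall u : 'rV_p, u *m A = 0 <-> exists w, u = w *m B.
Proof.
apply: (@fg_rows _ nR _ [set u : 'rV_p | u *m A = 0]).
apply/submoduleP; split=> [|a u v /= uA vA]; first by rewrite /= mul0mx.
by rewrite mulmxDl -scalemxAl uA vA scaler0 addr0.
Qed.

Lemma fres_exists (K : lmodType R) : fg K -> inhabited (fres K).
Proof.
move=> /fg_rVP[n0 [g gs]].
have [n1 [A0 A0E]] : exists n1 (A0 : 'M[R]_(n1, n0)),
    forall u, g u = 0 <-> exists w, u = w *m A0.
  apply: (@fg_rows _ nR _ [set u : 'rV_n0 | g u = 0]).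
  apply/submoduleP; split=> [|a u v /= gu gv]; first by rewrite /= linear0.
  by rewrite linearP gu gv scaler0 addr0.
(* A stage is a matrix together with its dimensions, so ranks and differentials come out of a single
   iteration. *)
pose T := {q : nat & {p : nat & 'M[R]_(p, q)}}.
have H : forall t : T, exists s : {r : nat & 'M[R]_(r, tag (tagged t))},
    forall u : 'rV_(tag (tagged t)), u *m tagged (tagged t) = 0 <-> exists w, u = w *m tagged s.
  by move=> [q [p A]]; have [r [B BE]] := syzygy_rows A; exists (existT _ r B).
pose nxt t := sval (cid (H t)); pose nxtP t := svalP (cid (H t)).
pose st i : T := iter i (fun t => existT _ (tag (tagged t)) (nxt t)) (existT _ n0 (existT _ n1 A0)).
constructor.
exact: (@Fres R K (fun i => tag (st i)) (fun i => tagged (tagged (st i))) g gs A0E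
  (fun i => nxtP (st i))).
Qed.

End Resolution.

(** * Matrices acting on powers of a module *)

Section MatrixAction.
Variable R : comNzRingType.
Implicit Types A B C M N V W : lmodType R.

(** For the map of free modules u |-> u *m X this is Hom(X, W) on powers of W; applied to the
    transpose of X it is X ox W. *)
Definition mact p q (X : 'M[R]_(p, q)) W (v : 'I_q -> W) : 'I_p -> W :=
  fun j => \sum_l X j l *: v l.

Fact mact_linear p q (X : 'M[R]_(p, q)) W : linear (@mact p q X W).
Proof.
move=> a u v; apply/funext => j.
transitivity (a *: (\sum_l X j l *: u l) + \sum_l X j l *: v l) => //; rewrite /mact.
rewrite scaler_sumr -big_split /=; apply: eq_bigr => l _.
by rewrite scalerDr !scalerA mulrC.
Qed.
HB.instance Definition _ p q (X : 'M[R]_(p, q)) W :=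
  GRing.isLinear.Build R ('I_q -> W) ('I_p -> W) _ (@mact p q X W) (mact_linear X (W:=W)).

Lemma mact_comp p q r (X : 'M[R]_(p, q)) (Y : 'M[R]_(q, r)) W (v : 'I_r -> W) :
  mact X (mact Y v) = mact (X *m Y) v.
Proof.
apply/funext => j; rewrite /mact.
under eq_bigr do rewrite scaler_sumr.
rewrite exchange_big /=; apply: eq_bigr => l _.
by rewrite mxE scaler_suml; apply: eq_bigr => k _; rewrite scalerA.
Qed.

Lemma mact0mx p q W (v : 'I_q -> W) : mact (0 : 'M[R]_(p, q)) v = 0.
Proof. by apply/funext => j; rewrite /mact big1 // => l _; rewrite mxE scale0r. Qed.

Lemma mactDmx p q (X Y : 'M[R]_(p, q)) W (v : 'I_q -> W) :
  mact (X + Y) v = mact X v + mact Y v.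
Proof.
apply/funext => j.
transitivity (\sum_l X j l *: v l + \sum_l Y j l *: v l) => //.
rewrite -big_split /=; by apply: eq_bigr => l _; rewrite mxE scalerDl.
Qed.

Lemma mact_scalar p (a : R) W (v : 'I_p -> W) : mact a%:M v = a *: v.
Proof.
apply/funext => j; transitivity (a *: v j) => //; rewrite /mact (bigD1 j) //= mxE eqxx mulr1n.
by rewrite big1 ?addr0 // => l /negPf lj; rewrite mxE eq_sym lj mulr0n scale0r.
Qed.

Lemma mact_map p q (X : 'M[R]_(p, q)) V W (f : {linear V -> W}) (v : 'I_q -> V) :
  f \o mact X v = mact X (f \o v).
Proof.
by apply/funext => j; rewrite /mact /= linear_sum; apply: eq_bigr => l _; rewrite linearZ.
Qed.

Definition exact r q p (B : 'M[R]_(r, q)) (A : 'M[R]_(q, p)) W : Prop :=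
  forall v : 'I_q -> W, mact B v = 0 -> exists w, v = mact A w.

Lemma compf0 n V W (f : {linear V -> W}) : f \o (0 : 'I_n -> V) = 0.
Proof. by apply/funext => j /=; exact: linear0. Qed.

Lemma compfB n V W (f : {linear V -> W}) (u v : 'I_n -> V) :
  f \o (u - v : 'I_n -> V) = (f \o u : 'I_n -> W) - (f \o v : 'I_n -> W).
Proof. by apply/funext => j /=; exact: linearB. Qed.

Lemma surj_pow n V W (f : {linear V -> W}) (v : 'I_n -> W) :
  (forall b, exists a, b = f a) -> exists u, v = f \o u.
Proof.
move=> fs; have /choice[u uE] := fun j => fs (v j).
by exists u; apply/funext => j; exact: uE.
Qed.

Lemma inj_pow n V W (f : {linear V -> W}) (u v : 'I_n -> V) :
  injective f -> f \o u = f \o v -> u = v.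
Proof. by move=> inj uv; apply/funext => j; apply: inj; exact: (congr1 (@^~ j) uv). Qed.

Section Chase.
Variables (L M N : lmodType R) (i : {linear L -> M}) (p : {linear M -> N}).
Hypothesis ip : ses i p.

Lemma ses_pow n (v : 'I_n -> M) : p \o v = 0 -> exists u, v = i \o u.
Proof.
case: ip => _ ex _ pv.
have /choice[u uE] : forall j, exists a, v j = i a.
  by move=> j; apply/ex; exact: (congr1 (@^~ j) pv).
by exists u; apply/funext.
Qed.

Lemma ses_pow0 n (u : 'I_n -> L) : p \o (i \o u) = 0.
Proof. by apply/funext => j /=; exact: (ses_comp0 _ ip). Qed.

Variables (s r q t : nat).
Variables (C : 'M[R]_(s, r)) (B : 'M[R]_(r, q)) (A : 'M[R]_(q, t)).

(** This and the next two lemmas are the segments of the long exact sequence of the complexes of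
    powers: a term vanishes when its two neighbours do. *)
Lemma exact_mid : B *m A = 0 -> exact B A L -> exact B A N -> exact B A M.
Proof.
move=> BA exL exN v Bv; have [iinj _ ps] := ip.
have [|w' w'E] := exN (p \o v); first by rewrite -mact_map Bv compf0.
have [w wE] := surj_pow w' ps.
have [u uE] : exists u, v - mact A w = i \o u.
  by apply: ses_pow; rewrite compfB mact_map -wE w'E subrr.
have [|u' u'E] := exL u.
  by apply: (inj_pow iinj); rewrite mact_map -uE linearB /= Bv mact_comp BA mact0mx subrr compf0.
by exists ((i \o u' : 'I_t -> M) + w); rewrite linearD /= -mact_map -u'E -uE subrK.
Qed.

Lemma exact_right : C *m B = 0 -> exact B A M -> exact C B L -> exact B A N.
Proof.
move=> CB exM exL v Bv; have [iinj _ ps] := ip.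
have [v' v'E] := surj_pow v ps.
have [u uE] : exists u, mact B v' = i \o u.
  by apply: ses_pow; rewrite mact_map -v'E.
have [|u' u'E] := exL u.
  by apply: (inj_pow iinj); rewrite mact_map -uE mact_comp CB mact0mx compf0.
have [|w wE] := exM (v' - (i \o u' : 'I_q -> M)).
  by rewrite linearB /= uE u'E mact_map subrr.
exists (p \o w); rewrite -mact_map -wE compfB -v'E ses_pow0 subr0 //.
Qed.

Lemma exact_left : B *m A = 0 -> exact B A N -> exact C B M -> exact C B L.
Proof.
move=> BA exN exM u Cu; have [iinj _ ps] := ip.
have [|v vE] := exM (i \o u); first by rewrite -mact_map Cu compf0.
have [|w' w'E] := exN (p \o v); first by rewrite -mact_map -vE ses_pow0.
have [w wE] := surj_pow w' ps.
have [u' u'E] : exists u', v - mact A w = i \o u'.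
  by apply: ses_pow; rewrite compfB mact_map -wE w'E subrr.
exists u'; apply: (inj_pow iinj).
by rewrite mact_map -u'E linearB /= mact_comp BA mact0mx subr0.
Qed.

End Chase.

Lemma exact_retract V W (i : {linear V -> W}) (p : {linear W -> V}) r q t
    (B : 'M[R]_(r, q)) (A : 'M[R]_(q, t)) :
  cancel i p -> exact B A W -> exact B A V.
Proof.
move=> ipK exW v Bv.
have [|w wE] := exW (i \o v); first by rewrite -mact_map Bv compf0.
by exists (p \o w); rewrite -mact_map -wE; apply/funext => j /=; rewrite ipK.
Qed.

Definition flatlike W : Prop := forall r q p (B : 'M[R]_(r, q)) (A : 'M[R]_(q, p)),
  exact B A R^o -> exact B A W.

Lemma flatlike_rV n : flatlike 'rV[R]_n.
Proof.
move=> r q p B A exR v Bv.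
have /choice[w wE] : forall l, exists w : 'I_p -> R^o, (fun j => v j 0 l : R^o) = mact A w.
  move=> l; apply: exR; apply/funext => j.
  transitivity (mact B v j 0 l); last by rewrite Bv mxE.
  by rewrite /mact summxE; apply: eq_bigr => k _; rewrite mxE.
exists (fun k => \row_l w l k); apply/funext => j; apply/rowP => l.
rewrite /mact summxE (congr1 (@^~ j) (wE l)) /mact.
by apply: eq_bigr => k _; rewrite !mxE.
Qed.

(** Infinite bases occur because the canonical resolution behind [Tor] is free on the underlying set
    of a module. *)
Lemma flatlike_freeg (K : choiceType) : flatlike {freeg K / R}.
Proof.
move=> r q p B A exR v Bv.
pose U := undup (flatten [seq dom (v j) | j : 'I_q]).
have vU j x : x \in dom (v j) -> x \in U.
  move=> xv; rewrite mem_undup; apply/flattenP; exists (dom (v j)) => //.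
  by apply/mapP; exists j => //; rewrite mem_enum.
have /choice[w wE] : forall x, exists w : 'I_p -> R^o,
    (fun j => coeff x (v j) : R^o) = mact A w.
  move=> x; apply: exR; apply/funext => j.
  transitivity (coeff x (mact B v j)); last by rewrite Bv coeff0.
  by rewrite /mact raddf_sum /=; apply: eq_bigr => k _; rewrite coeffZ.
(* A coordinatewise solution [w x] need not vanish outside the supports of v, so only the finitely
   many x in U are kept. *)
exists (fun k => \sum_(x <- U) w x k *: << x >>).
have wU y k : coeff y (\sum_(x <- U) w x k *: << x >> : {freeg K / R}) =
    if y \in U then w y k else 0.
  rewrite raddf_sum /=; under eq_bigr do rewrite coeffZ coeffU mul1r.
  case: ifPn => yU.
    rewrite (bigD1_seq y) ?undup_uniq //= eqxx mulr1 big1 ?addr0 // => x /negPf ->.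
    by rewrite mulr0.
  rewrite big_seq big1 // => x xU; case: eqP yU => [<-|]; first by rewrite xU.
  by rewrite mulr0.
apply/funext => j; apply/eqP/freeg_eqP => y; rewrite /mact raddf_sum /=.
case yU: (y \in U); under eq_bigr do rewrite coeffZ wU yU; first exact: (congr1 (@^~ j) (wE y)).
rewrite big1 => [|k _]; last by rewrite mulr0.
by apply/coeff_outdom/negP => /vU; rewrite yU.
Qed.

End MatrixAction.

(** * Local rings *)

Section Local.
Variables (R : comNzRingType) (m : set R).
Hypotheses (nR : noetherian R) (lR : local_ring m).
Implicit Types A B C L M N V W : lmodType R.

Let mI : @submodule R R^o m.
Proof. by case: lR => -[]. Qed.

Lemma max_ideal0 : m 0.
Proof. by case: ((@submoduleP _ R^o _).1 mI). Qed.

Lemma max_idealP a x y : m x -> m y -> m (a * x + y).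
Proof. by case: ((@submoduleP _ R^o _).1 mI) => _; apply. Qed.

Lemma max_ideal1 : ~ m 1.
Proof. by case: lR => -[]. Qed.

Lemma max_idealM a x : m x -> m (a * x).
Proof. by move=> mx; rewrite -[_ * _]addr0; exact: max_idealP mx max_ideal0. Qed.

Lemma max_idealD x y : m x -> m y -> m (x + y).
Proof. by move=> mx my; rewrite -[x]mul1r; exact: max_idealP. Qed.

(** An ideal maximal among those that contain x and avoid 1 is a maximal ideal, hence equals m. *)
Lemma max_ideal_unit x : ~ m x -> exists y, y * x = 1.
Proof.
move=> nmx; apply: contrapT => nu.
pose Ix : set R^o := [set z | exists a : R, z = a * x].
have sI : submodule Ix.
  apply/submoduleP; split; first by exists 0; rewrite mul0r.
  by move=> a _ _ [b ->] [c ->]; exists (a * b + c); rewrite mulrDl -mulrA.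
pose P (J : set R^o) := ~ J 1 /\ J x.
have [| |J [sJ [J1 Jx] Jmax]] := @max_submodule R nR R^o P Ix _ sI.
- exact: noeth_fg (@noeth_ring R nR).
- split; last by exists 1; rewrite mul1r.
  by move=> [y /esym yx]; apply: nu; exists y.
apply: nmx; rewrite -(lR.2 J) //; split=> // I sI' I1 JI.
apply/seteqP; split=> //; apply: Jmax => //; split=> //; exact: JI.
Qed.

Lemma max_ideal_unit1B x : m x -> exists y, y * (1 - x) = 1.
Proof.
move=> mx; apply: max_ideal_unit => m1x; apply: max_ideal1.
by rewrite -[1](subrK x); exact: max_idealD.
Qed.

(** Gaussian elimination: 1 - c_0 is a unit, so the first relation is solved for the first vector
    and substituted into the others. V may be a function space and B a module of coboundaries in
    it. *)
Lemma nakayama (V : lmodType R) (B : set V) n (f : 'I_n -> V) :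
  submodule B ->
  (forall j, exists2 c : 'I_n -> R, forall l, m (c l) & B (f j - \sum_l c l *: f l)) ->
  forall j, B (f j).
Proof.
move=> /submoduleP[B0 BL]; elim: n f => [|n IH] f H; first by case.
have BZ a u : B u -> B (a *: u) by move=> Bu; rewrite -[_ *: _]addr0; exact: BL.
have BD u v : B u -> B v -> B (u + v) by move=> Bu Bv; rewrite -[u]scale1r; exact: BL.
have [c mc] := H ord0; rewrite big_ord_recl => Bc.
have [y y1] := max_ideal_unit1B (mc ord0).
set T := \sum_(l < n) _ in Bc.
have {}Bc : B (f ord0 - y *: T).
  have := BZ y _ Bc; rewrite opprD addrA -{1}[f ord0]scale1r -scalerBl scalerBr scalerA.
  by rewrite y1 scale1r.
have {}IH : forall j, B (f (fintype.lift ord0 j)).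
  apply: IH => j; have [d md] := H (fintype.lift ord0 j).
  rewrite big_ord_recl => Bd.
  exists (fun l => d ord0 * y * c (fintype.lift ord0 l) + d (fintype.lift ord0 l)).
    by move=> l; exact: max_idealP.
  have := BD _ _ (BZ (d ord0) _ Bc) Bd.
  under [in X in _ -> X]eq_bigr do rewrite scalerDl -scalerA.
  rewrite big_split /= -scaler_sumr -/T scalerBr scalerA; set S := \sum_l _.
  congr (B _); rewrite !opprD addrCA; congr (_ + _).
  by rewrite addrACA subrr add0r.
move=> j; case: (unliftP ord0 j) => [k ->//|->].
rewrite -[f ord0](subrK (y *: T)); apply: BD => //; apply: BZ.
by rewrite /T; elim/big_rec: _ => // l u _ Bu; exact: BL.
Qed.

Lemma nakayama_sub M (T : set M) : fg M -> submodule T ->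
  (forall t, T t -> exists x u, [/\ m x, T u & t = x *: u]) ->
  forall t, T t -> t = 0.
Proof.
move=> fM sT H; have [n [g [Tg gT]]] := fg_noeth nR fM sT.
have g0 j : g j = 0.
  apply: (@nakayama M [set 0] n g) => [|{}j].
    by apply/submoduleP; split=> // a u v /= -> ->; rewrite scaler0 addr0.
  have [x [u [mx Tu ->]]] := H _ (Tg j); have [c ->] := gT _ Tu.
  exists (fun l => x * c l); first by move=> l; rewrite mulrC; exact: max_idealM.
  by rewrite /= scaler_sumr -sumrB big1 // => l _; rewrite scalerA subrr.
by move=> t /gT[u ->]; rewrite big1 // => j _; rewrite g0 scaler0.
Qed.

(** ** Regular elements *)

Definition socle M : Prop := exists2 z : M, z <> 0 & forall a, m a -> a *: z = 0.

Definition ann M (w : M) : set R := [set a | a *: w = 0].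

(** Maximal annihilators stand in for associated primes: they are prime, and every zero divisor lies
    in one. *)
Definition maxann M (w : M) : Prop :=
  w <> 0 /\ forall w' : M, w' <> 0 -> ann w `<=` ann w' -> ann w' `<=` ann w.

Lemma ann_ideal M (w : M) : @submodule R R^o (ann w).
Proof.
apply/submoduleP; split=> [|a x y xw yw]; rewrite /ann /= ?scale0r //.
by rewrite scalerDl -scalerA xw yw scaler0 addr0.
Qed.

Lemma maxann_exists M (z : M) : z <> 0 -> exists2 w : M, maxann w & ann z `<=` ann w.
Proof.
move=> z0; pose P (J : set R^o) := exists2 w : M, w <> 0 & J = ann w /\ ann z `<=` J.
have [| |J [_ [w w0 [-> zw]] Jmax]] := @max_submodule R nR R^o P (ann z) _ (ann_ideal z).
- exact: noeth_fg (@noeth_ring R nR).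
- by exists z => //; split.
exists w => //; split=> // w' w'0 ww'; apply: (Jmax _ _ _ ww'); first exact: ann_ideal.
by exists w' => //; split=> //; apply: subset_trans ww'.
Qed.

Lemma maxann_prime M (w : M) a b : maxann w -> ann w (a * b) -> ann w a \/ ann w b.
Proof.
move=> [w0 wmax] abw; have [bw|bw] := pselect (b *: w = 0); first by right.
left; apply: (wmax _ bw); first by move=> c cw; rewrite /ann /= scalerA mulrC -scalerA cw scaler0.
by rewrite /ann /= scalerA.
Qed.

(* Take U maximal among the submodules admitting x in m that avoids every
   maximal annihilator containing ann U.  If x w = 0 with ann w maximal, then
   ann U is not contained in ann w; adding to x an element of m * ann U outside
   ann w would allow U + R w. *)
Lemma regular_or_socle M : fg M ->
  (exists2 x, m x & forall z : M, x *: z = 0 -> z = 0) \/ socle M.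
Proof.
move=> fM; have [soc|nsoc] := pselect (socle M); [by right|left].
pose annS (U : set M) : set R := [set a | forall u, U u -> a *: u = 0].
pose ok (U : set M) x := m x /\ forall w : M, maxann w -> annS U `<=` ann w -> ~ ann w x.
have [||U [sU [x [mx xU]] Umax]] := @max_submodule R nR M (fun U => exists x, ok U x) [set 0] fM.
- by apply/submoduleP; split=> // a u v /= -> ->; rewrite scaler0 addr0.
- exists 0; split=> [|w [w0 _] /(_ 1)]; first exact: max_ideal0.
  move=> H _; apply: w0; rewrite -[w]scale1r; apply: H => u ->.
  by rewrite scaler0.
have [U0 UL] := (submoduleP U).1 sU.
exists x => // z xz; apply: contrapT => z0.
have [w mw zw] := maxann_exists z0.
have xw : ann w x by exact: zw.
have [t Ut tw] : exists2 t, annS U t & ~ ann w t.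
  apply: contrapT => H; case: (xU w mw) => // a aU.
  by apply: contrapT => aw; apply: H; exists a.
have [s ms sw] : exists2 s, m s & ~ ann w s.
  apply: contrapT => H; apply: nsoc; exists w; first by case: mw.
  by move=> a ma; apply: contrapT => aw; apply: H; exists a.
have stw : ~ ann w (t * s) by move=> /(maxann_prime mw)[].
pose V := [set u : M | exists a, U (u - a *: w)].
have sV : submodule V.
  apply/submoduleP; split; first by exists 0; rewrite scale0r subr0.
  move=> a u v [b Ub] [c Uc]; exists (a * b + c).
  rewrite scalerDl opprD addrACA -scalerA -scalerBr; exact: UL.
have UV : U `<=` V by move=> u Uu; exists 0; rewrite scale0r subr0.
have Vw : V w by exists 1; rewrite scale1r subrr.
have nUw : ~ U w by move=> Uw; apply: tw; exact: Ut.
apply: nUw; apply: (Umax V sV _ UV) => //.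
exists (x + t * s); split; first by apply: max_idealD => //; exact: max_idealM.
move=> w' mw' Vw'; rewrite /ann /= => xts.
have [Uw'|] := pselect (annS U `<=` ann w').
  apply: (xU w' mw' Uw'); have tw' : ann w' t by exact: Uw'.
  have : x *: w' + (t * s) *: w' = 0 by rewrite -scalerDl.
  by rewrite mulrC -scalerA tw' scaler0 addr0.
move=> /existsNP[b /not_implyP[Ub bw']].
have ww' : ann w `<=` ann w'.
  move=> a aw; have [] := @maxann_prime _ w' b a mw' _ => //; apply: Vw' => v [c Uc].
  rewrite -[v](subrK (c *: w)) scalerDr mulrC -scalerA (Ub _ Uc) scaler0 add0r.
  by rewrite scalerA -mulrA mulrC -scalerA aw scaler0.
have w'w : ann w' `<=` ann w by apply: mw.2 ww'; case: mw'.
have : ann w (x + t * s) by exact: w'w.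
by rewrite /ann /= scalerDl xw add0r => /stw.
Qed.

End Local.

(** * Depth through the vanishing of Ext(k, -) *)

Section Depth.
Variables (R : comNzRingType) (m : set R).
Hypotheses (nR : noetherian R) (lR : local_ring m).
Implicit Types A B C L M N V W : lmodType R.

Definition residue : lmodType R := modquot (m : set (R^o)).

Lemma residue_eq0 (a : R) : modproj (m : set R^o) a = 0 <-> m a.
Proof. by apply: modproj_eq0E; case: lR => -[]. Qed.

Lemma residueM (a b : R) :
  modproj (m : set R^o) (a * b) = a *: (modproj (m : set R^o) b : residue).
Proof. exact: (esym (@modquot_scaleE R R^o m a b)). Qed.

Lemma residue_kill a (z : residue) : m a -> a *: z = 0.
Proof.
move=> ma; have [x ->] := modproj_surj z; rewrite -linearZ; apply/residue_eq0.
by rewrite [_ *: _]mulrC; exact: max_idealM.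
Qed.

Lemma fg_residue : fg residue.
Proof.
apply: (@fg_surj R R^o residue (modproj _)); first exact: modproj_surj.
exact: noeth_fg (@noeth_ring R nR).
Qed.

Lemma rows_lift (K : lmodType R) (F : fres K) p i (X : 'M[R]_(p, rk F i.+1)) :
  X *m dmx F i = 0 -> exists H, X = H *m dmx F i.+1.
Proof.
move=> X0; have /choice[h hE] : forall j, exists w, row j X = w *m dmx F i.+1.
  by move=> j; apply/dmx_exact; rewrite -row_mul X0 row0.
exists (\matrix_j h j); apply/row_matrixP => j.
by rewrite row_mul rowK -hE.
Qed.

Lemma dmx_comp (K : lmodType R) (F : fres K) i : dmx F i.+1 *m dmx F i = 0.
Proof.
apply/row_matrixP => j; rewrite row_mul row0; apply/dmx_exact.
by exists (delta_mx 0 j); rewrite -rowE.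
Qed.

Variable F : fres residue.

(** The resolution is moved up one place with 0 in front, so that Ext^0(k, -) is treated like the
    higher degrees. *)
Definition krk i := if i is i'.+1 then rk F i' else 0%N.

Definition kmx i : 'M[R]_(krk i.+1, krk i) :=
  match i with 0 => 0 | i'.+1 => dmx F i' end.

Lemma kmx_comp i : kmx i.+1 *m kmx i = 0.
Proof. by case: i => [|i]; [rewrite mulmx0|exact: dmx_comp]. Qed.

(** Multiplication by x is zero on k, hence null-homotopic on its resolution. *)
Lemma kmx_homotopy x i : m x ->
  exists (h : 'M[R]_(krk i.+1, krk i.+2)) (h' : 'M[R]_(krk i, krk i.+1)),
    x%:M = h *m kmx i.+1 + kmx i *m h'.
Proof.
move=> mx; elim: i => [|i [h [h' E]]].
  have /choice[h hE] : forall j : 'I_(rk F 0), exists w,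
      row j (x%:M : 'M_(rk F 0)) = w *m dmx F 0.
    by move=> j; apply/aug_ker; rewrite rowE mul_mx_scalar linearZ /= residue_kill.
  exists (\matrix_j h j), 0; rewrite mulmx0 addr0; apply/row_matrixP => j.
  by rewrite row_mul rowK -hE.
(* By the identity in the degree below, x - d h composed with the next differential is 0, so it
   lifts. *)
have [|H HE] := @rows_lift _ F _ i (x%:M - dmx F i *m h : 'M_(rk F i.+1)).
  rewrite mulmxBl mul_scalar_mx -mulmxA -/(kmx i.+1).
  have -> : h *m kmx i.+1 = x%:M - kmx i *m h' by rewrite E addrK.
  by rewrite mulmxBr mulmxA kmx_comp mul0mx subr0 mul_mx_scalar subrr.
by exists H, h; rewrite -HE subrK.
Qed.

Lemma ext_kill x i W (v : 'I_(krk i.+1) -> W) : m x -> mact (kmx i.+1) v = 0 ->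
  exists w, x *: v = mact (kmx i) w.
Proof.
move=> mx v0; have [h [h' E]] := kmx_homotopy i mx.
exists (mact h' v); rewrite -mact_scalar E mactDmx -!mact_comp v0 linear0 add0r //.
Qed.

(** Ext^i(k, W) = 0 for i < n, that is, depth at least n for finitely generated W; the zero module
    satisfies it for all n, in accordance with its infinite depth. *)
Definition dp n W : Prop := forall i, (i < n)%N -> exact (kmx i.+1) (kmx i) W.

Lemma dp_le n k W : (k <= n)%N -> dp n W -> dp k W.
Proof. by move=> kn dW i ik; apply: dW; exact: leq_trans ik kn. Qed.

Lemma dp_zero n W : (forall x : W, x = 0) -> dp n W.
Proof. by move=> W0 i _ v _; exists 0; apply/funext => j; rewrite [RHS](W0 _) (W0 (v j)). Qed.

Lemma dp_retract n V W (i : {linear V -> W}) (p : {linear W -> V}) :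
  cancel i p -> dp n W -> dp n V.
Proof. by move=> ip dW j jn; apply: exact_retract ip _; exact: dW. Qed.

Lemma dp_flat n W : flatlike W -> dp n R^o -> dp n W.
Proof. by move=> fW dR i /dR; exact: fW. Qed.

Lemma exact0_sub L M (i : {linear L -> M}) : injective i ->
  exact (kmx 1) (kmx 0) M -> exact (kmx 1) (kmx 0) L.
Proof.
move=> inj exM v v0; have [|w wE] := exM (i \o v).
  by rewrite -mact_map v0 compf0.
exists 0; apply: (inj_pow inj).
by rewrite wE mact_map !mact0mx.
Qed.

Section DpSes.
Variables (L M N : lmodType R) (i : {linear L -> M}) (p : {linear M -> N}).
Hypothesis ip : ses i p.

(** The kernel of Ext^n(k, L) -> Ext^n(k, M) is a quotient of Ext^{n-1}(k, N) = 0. *)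
Lemma coboundary_lift n (v : 'I_(krk n.+1) -> L) w : dp n N ->
  i \o v = mact (kmx n) w -> exists u, v = mact (kmx n) u.
Proof.
case: n v w => [|n] v w dN vw; have [iinj _ ps] := ip.
  by exists 0; apply: (inj_pow iinj); rewrite vw mact_map !mact0mx.
have [|w' w'E] := dN n (ltnSn n) (p \o w).
  by rewrite -mact_map -vw (ses_pow0 ip).
have [w'' w''E] := surj_pow w' ps.
have [u uE] : exists u, w - mact (kmx n) w'' = i \o u.
  by apply: (ses_pow ip); rewrite compfB mact_map -w''E w'E subrr.
exists u; apply: (inj_pow iinj).
by rewrite mact_map -uE linearB /= mact_comp kmx_comp mact0mx subr0.
Qed.

Lemma dp_mid n : dp n L -> dp n N -> dp n M.
Proof.
by move=> dL dN j jn; apply: (exact_mid ip (kmx_comp j)); [exact: dL|exact: dN].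
Qed.

Lemma dp_right n : dp n M -> dp n.+1 L -> dp n N.
Proof.
move=> dM dL j jn; apply: (exact_right ip (kmx_comp j.+1)); first exact: dM.
by apply: dL.
Qed.

Lemma dp_left n : dp n N -> dp n.+1 M -> dp n.+1 L.
Proof.
move=> dN dM [|j] jn; first by have [inj _ _] := ip; exact: exact0_sub inj (dM _ jn).
by apply: (exact_left ip (kmx_comp j)); [exact: dN|exact: dM].
Qed.

Lemma dp_left' n : dp n N -> dp n M -> dp n L.
Proof.
move=> dN dM [|j] jn; first by have [inj _ _] := ip; exact: exact0_sub inj (dM _ jn).
by apply: (exact_left ip (kmx_comp j)); [apply: dN; exact: ltnW|exact: dM].
Qed.

End DpSes.

Section Regular.
Variables (M N : lmodType R) (x : R) (p : {linear M -> N}).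
Hypotheses (mx : m x) (xp : ses ( *:%R x : {linear M -> M}) p).

(** x kills Ext(k, M), so for a cocycle v the multiple x v is the coboundary of some w. The image of
    w in N is a cocycle, hence a coboundary, and w can be changed to some x u; then v is the
    coboundary of u. *)
Lemma dp_regular n : dp n N -> dp n.+1 M.
Proof.
move=> dN [|i] jn v v0.
  have [w wE] := ext_kill mx v0; exists w.
  have [xinj _ _] := xp; apply: (inj_pow xinj); rewrite mact_map [LHS]wE.
  by rewrite !mact0mx.
have [w wE] := ext_kill mx v0; have [xinj _ ps] := xp.
have [|w' w'E] := dN i jn (p \o w).
  rewrite -mact_map -wE; apply/funext => j /=.
  by rewrite [X in p X]/GRing.scale /=; exact: (ses_comp0 _ xp).
have [w'' w''E] := surj_pow w' ps.
have [u uE] : exists u, w - mact (kmx i) w'' = ( *:%R x : {linear M -> M}) \o u.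
  by apply: (ses_pow xp); rewrite compfB mact_map -w''E w'E subrr.
exists u; apply: (inj_pow xinj); rewrite mact_map -uE linearB /=.
by rewrite mact_comp kmx_comp mact0mx subr0 -wE.
Qed.

End Regular.

Lemma dp1_socle M : dp 1 M <-> ~ socle m M.
Proof.
split=> [dM [z z0 mz]|nsoc [|//] _ v v0]; last first.
  exists 0; rewrite linear0; apply/funext => j; apply: contrapT => vj.
  apply: nsoc; exists (v j) => // a ma.
  have [w] := ext_kill ma v0; rewrite mact0mx => /(congr1 (@^~ j)) //.
(* The map k -> M with 1 |-> z, written on the generators of the resolution: e_j is the class of s_j
   and goes to s_j z. *)
pose e j := aug F (delta_mx 0 j); pose s j := repr (e j).
have sE j : modproj (m : set R^o) (s j) = e j by exact: reprK.
have [|w] := dM 0%N isT (fun j : 'I_(rk F 0) => (s j : R) *: z).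
  apply/funext => l; rewrite /mact.
  under eq_bigr do rewrite scalerA.
  rewrite -scaler_suml; apply: mz; apply/residue_eq0.
  rewrite (raddf_sum (modproj _)).
  transitivity (aug F (row l (dmx F 0))); last first.
    by apply/aug_ker; exists (delta_mx 0 l); rewrite -rowE.
  rewrite [RHS]rV_linE; apply: eq_bigr => j _; rewrite !mxE.
  by rewrite /= residueM sE.
rewrite mact0mx => sz.
have {}sz j : (s j : R) *: z = 0 by exact: (congr1 (@^~ j) sz).
have [u uE] := aug_surj F (modproj (m : set R^o) 1).
(* 1 is a combination of the s_j modulo m, so s_j z = 0 for all j forces z = 0. *)
have m1 : m (1 - \sum_j u 0 j * s j).
  apply/residue_eq0; rewrite raddfB /= uE rV_linE (raddf_sum (modproj _)) /=.
  rewrite -sumrB big1 // => j _; apply/eqP; rewrite subr_eq0; apply/eqP.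
  by rewrite residueM sE.
apply: z0; have := mz _ m1; rewrite scalerBl scale1r scaler_suml big1 ?subr0 //.
by move=> j _; rewrite -scalerA sz scaler0.
Qed.

Lemma dp1_regular M : fg M -> dp 1 M ->
  exists2 x, m x & injective ( *:%R x : {linear M -> M}).
Proof.
move=> fM /dp1_socle nsoc; case: (regular_or_socle nR lR fM) => [[x mx xM]|//].
by exists x => //; apply: lin_inj.
Qed.

(** ** Regular sequences *)

Local Notation "M // s" := (modquot (smul_gens M s)) (at level 40).

Lemma smul_gens_rcons M s x v : lspan (smul_gens M (rcons s x)) v <->
  exists w, lspan (smul_gens M s) (v - x *: w).
Proof.
split=> [|[w sw]].
  move: v; apply: (@lspan_min R M _ [set v | exists w, lspan (smul_gens M s) (v - x *: w)]).
    apply/submoduleP; split; first by exists 0; rewrite scaler0 subr0; exact: lspan0.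
    move=> a u v [w sw] [w' sw']; exists (a *: w + w').
    rewrite scalerDr opprD addrACA scalerA mulrC -scalerA -scalerBr.
    exact: lspanL.
  move=> _ [a + [v ->]]; rewrite mem_rcons inE => /orP[/eqP ->|as_] /=.
    by exists v; rewrite subrr; exact: lspan0.
  by exists 0; rewrite scaler0 subr0; apply: sub_lspan; exists a => //; exists v.
rewrite -[v](subrK (x *: w)); apply: lspanD.
  move: sw; apply: lspan_min; first exact: lspan_submodule.
  move=> _ [a as_ [u ->]]; apply: sub_lspan; exists a; last by exists u.
  by rewrite mem_rcons inE as_ orbT.
by apply: sub_lspan; exists x; [rewrite mem_rcons inE eqxx|exists w].
Qed.

Lemma regular_ses M s x : (forall z : M // s, x *: z = 0 -> z = 0) ->
  exists p : {linear M // s -> M // (rcons s x)},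
    ses ( *:%R x : {linear M // s -> M // s}) p.
Proof.
move=> xreg.
have [p pE] : exists p : {linear M // s -> M // (rcons s x)},
    forall v, p (modproj _ v) = modproj _ v.
  apply: (@lin_factor R M (M // s) (M // (rcons s x)) (modproj _) (modproj _)).
    exact: modproj_surj.
  move=> v /modproj_eq0 sv; apply/modproj_eq0/smul_gens_rcons.
  by exists 0; rewrite scaler0 subr0.
exists p; split; first exact: lin_inj.
  move=> z; have [v ->] := modproj_surj z; rewrite pE modproj_eq0 smul_gens_rcons.
  split=> [[w sw]|[a]].
    exists (modproj _ w); apply/eqP; rewrite -subr_eq0 /= -linearZ -linearB.
    by apply/eqP/modproj_eq0.
  have [w ->] := modproj_surj a => vw; exists w.
  by apply/modproj_eq0; rewrite linearB linearZ /= vw subrr.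
by move=> c; have [v ->] := modproj_surj c; exists (modproj _ v); rewrite pE.
Qed.

Lemma quot_nil M : exists p : {linear M // [::] -> M},
  (forall v, p (modproj _ v) = v) /\ forall z, modproj _ (p z) = z.
Proof.
have [||p pE] := @lin_factor R M (M // [::]) M (modproj _) idfun.
- exact: modproj_surj.
- move=> v /modproj_eq0; move: v; apply: (@lspan_min R M _ [set 0]).
    by apply/submoduleP; split=> // a u v /= -> ->; rewrite scaler0 addr0.
  by move=> z [a].
exists p; split=> // z; have [v ->] := modproj_surj z.
by rewrite pE.
Qed.

(** [regular_seq] without the nonzero final quotient, which Nakayama supplies when M is nonzero and
    the sequence lies in m. *)
Definition regular_upto M (s : seq R) : Prop :=
  forall i, (i < size s)%N -> forall z : M // (take i s), s`_i *: z = 0 -> z = 0.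

Lemma regular_upto_rcons M s x : regular_upto M (rcons s x) <->
  regular_upto M s /\ forall z : M // s, x *: z = 0 -> z = 0.
Proof.
rewrite /regular_upto size_rcons; split=> [reg|[reg xreg i]].
  split=> [i lti|]; last first.
    by have := reg _ (ltnSn _); rewrite nth_rcons ltnn eqxx -cats1 take_size_cat.
  have := reg i (ltnW lti); rewrite nth_rcons lti -cats1 takel_cat //.
  exact: ltnW.
rewrite ltnS leq_eqVlt => /orP[/eqP ->|lti].
  by rewrite nth_rcons ltnn eqxx -cats1 take_size_cat.
by rewrite nth_rcons lti -cats1 takel_cat; [exact: reg|exact: ltnW].
Qed.

Lemma regular_upto_dp M s n : [set` s] `<=` m -> regular_upto M s ->
  dp n (M // s) -> dp (n + size s) M.
Proof.
elim/last_ind: s n => [|s x IH] n sm.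
  move=> _ dM; rewrite addn0; have [p [pE _]] := quot_nil M.
  exact: dp_retract pE dM.
move=> /regular_upto_rcons[reg xreg] dM; rewrite size_rcons -addSnnS.
apply: IH => //; first by move=> y ys; apply: sm; rewrite /= mem_rcons inE ys orbT.
have [p xp] := regular_ses xreg.
by apply: (dp_regular _ xp dM); apply: sm; rewrite /= mem_rcons inE eqxx.
Qed.

Lemma dp_regular_upto M n k : fg M -> dp (n + k) M ->
  exists s, [/\ [set` s] `<=` m, size s = k, regular_upto M s & dp n (M // s)].
Proof.
move=> fM; elim: k n => [|k IH] n dM.
  exists [::]; split=> //; have [p [_ pK]] := quot_nil M.
  by apply: dp_retract pK _; rewrite -[n]addn0.
have [|s [sm sk reg dMs]] := IH n.+1; first by rewrite addSnnS.
have fMs : fg (M // s) by apply: fg_surj fM; exact: modproj_surj.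
have [x mx xinj] := dp1_regular fMs (dp_le (ltn0Sn n) dMs).
have xreg (z : M // s) : x *: z = 0 -> z = 0 by move=> xz; exact: (lin_inj0 xinj).
have [p xp] := regular_ses xreg; exists (rcons s x); split.
- by move=> y; rewrite /= mem_rcons inE => /orP[/eqP ->//|]; exact: sm.
- by rewrite size_rcons sk.
- by apply/regular_upto_rcons.
- exact (dp_right xp (dp_le (leqnSn n) dMs) dMs).
Qed.

Lemma quot_nonzero M s : fg M -> nonzero M -> [set` s] `<=` m -> nonzero (M // s).
Proof.
move=> [n [g [_ gM]]] [y y0] sm; apply: contrapT => nz.
have sM v : lspan (smul_gens M s) v.
  apply/modproj_eq0; apply: contrapT => v0; apply: nz.
  by exists (modproj _ v); apply/eqP.
case/eqP: y0; have [u ->] := gM y I; rewrite big1 // => j _.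
rewrite (_ : g j = 0) ?scaler0 //.
apply: (nakayama nR lR (V := M) (B := [set 0]) (f := g)).
  by apply/submoduleP; split=> // a v w /= -> ->; rewrite scaler0 addr0.
move=> {}j.
suff [c mc ->] : exists2 c : 'I_n -> R, forall l, m (c l) & g j = \sum_l c l *: g l.
  by exists c => //; rewrite subrr.
move: (sM (g j)); move: (g j); apply: lspan_min.
  apply/submoduleP; split.
    exists (fun=> 0); first by move=> l; exact: max_ideal0.
    by rewrite big1 // => l _; rewrite scale0r.
  move=> a _ _ [c mc ->] [d md ->]; exists (fun l => a * c l + d l).
    by move=> l; exact: max_idealP.
  rewrite scaler_sumr -big_split /=; apply: eq_bigr => l _.
  by rewrite scalerDl scalerA.
move=> _ [a as_ [v ->]]; have [c ->] := gM v I.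
exists (fun l => a * c l); first by move=> l; rewrite mulrC; apply: max_idealM => //; exact: sm.
by rewrite scaler_sumr; apply: eq_bigr => l _; rewrite scalerA.
Qed.

(** Each vanishing of Hom(k, -) supplies one more regular element, and conversely a regular sequence
    of length n forces [dp n]. *)
Lemma depthE M a : fg M -> nonzero M -> dp a M -> ~ dp a.+1 M ->
  depth m M = ((a%:Z)%:E)%E.
Proof.
move=> fM nzM dM ndM; rewrite /depth asboolT //.
have [|s [sm sa reg _]] := @dp_regular_upto M 0 a fM; first by [].
set S := (X in supremum _ X).
have Sa : S (a%:Z)%:E%E.
  by exists s; rewrite ?sa //; split=> //; split=> //; exact: quot_nonzero.
have Smax x : S x -> (x <= (a%:Z)%:E)%E.
  move=> [t [tm [tr _]] <-]; rewrite lee_fin lez_nat leqNgt; apply/negP => lt.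
  apply: ndM; apply: (dp_le lt); rewrite -[size t]add0n.
  exact: regular_upto_dp.
have supa : supremums S (a%:Z)%:E%E by split=> // y; apply.
rewrite /supremum; case: eqP => [S0|_]; first by have := Sa; rewrite S0.
by case: xgetP => [y _ supy|/(_ _ supa)//]; exact: (is_subset1_supremums supy supa).
Qed.

End Depth.

(** * Ext(-, R) over a Gorenstein local ring *)

Section LinearForms.
Variable R : comNzRingType.
Implicit Types A B C M W : lmodType R.

Lemma inj_extend A B W (i : {linear A -> B}) (f : {linear A -> W}) :
  injective_module W -> (forall a, i a = 0 -> f a = 0) ->
  exists g : {linear B -> W}, forall a, g (i a) = f a.
Proof.
move=> injW fker.
have [Q [p [kiE ps]]] : exists (Q : lmodType R) (p : {linear A -> Q}),
    (forall a, p a = 0 <-> i a = 0) /\ forall b, exists a, b = p a.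
  exists (modquot (range (val : ker i -> A))), (modproj _ : {linear _ -> _}).
  split=> [a|]; last exact: modproj_surj.
  rewrite coker_exact; split=> [[b ->]|ia]; first exact/eqP/(valP b).
  have ak : a \in ker_pred i by apply/eqP.
  by exists (Ker ak).
have [i' i'E] : exists i' : {linear Q -> B}, forall a, i' (p a) = i a.
  by apply: lin_factor => // a /kiE.
have [f' f'E] : exists f' : {linear Q -> W}, forall a, f' (p a) = f a.
  by apply: lin_factor => // a /kiE/fker.
have [|g gE] := injW _ _ i' f'.
  apply: lin_inj => z; have [a ->] := ps z; rewrite i'E => ia.
  exact/kiE.
by exists g => a; rewrite -i'E gE f'E.
Qed.

Lemma fct_combE (T : Type) W r (c : 'I_r -> R) (f : 'I_r -> T -> W) x :
  (\sum_j c j *: f j) x = \sum_j c j *: f j x.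
Proof. by rewrite fct_sumE. Qed.

Lemma lin_comb M W r (c : 'I_r -> R) (f : 'I_r -> {linear M -> W}) :
  exists g : {linear M -> W}, forall x, g x = \sum_j c j *: f j x.
Proof.
have lg : linear (fun x => \sum_j c j *: f j x).
  move=> a u v; under eq_bigr do rewrite linearP scalerDr scalerA mulrC -scalerA.
  by rewrite big_split /= -scaler_sumr.
by exists (linmap lg).
Qed.

Definition dotv n (w : 'rV[R]_n) (b : 'rV[R]_n) : R^o := (b *m w^T) 0 0.

Fact dotv_linear n (w : 'rV[R]_n) : linear (dotv w).
Proof. by move=> a u v; rewrite /dotv mulmxDl -scalemxAl !mxE. Qed.
HB.instance Definition _ n (w : 'rV[R]_n) :=
  GRing.isLinear.Build R 'rV[R]_n R^o _ (dotv w) (dotv_linear w).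

Lemma dotvC n (w b : 'rV[R]_n) : dotv w b = dotv b w.
Proof. by rewrite /dotv -[b *m _]trmxK trmx_mul trmxK mxE. Qed.

Lemma dotv_mulmx n k (A : 'M[R]_(n, k)) (w : 'rV_n) (b : 'rV_k) :
  dotv b (w *m A) = dotv (b *m A^T) w.
Proof. by rewrite /dotv trmx_mul trmxK mulmxA. Qed.

Lemma dotvP n (psi : {linear 'rV[R]_n -> R^o}) : exists w, forall b, psi b = dotv w b.
Proof.
exists (\row_j psi (delta_mx 0 j)) => b; rewrite rV_linE /dotv mxE.
by apply: eq_bigr => j _; rewrite !mxE.
Qed.

Lemma dotv_inj n (u v : 'rV[R]_n) : (forall w, dotv w u = dotv w v) -> u = v.
Proof.
move=> uv; apply/rowP => j; have := uv (delta_mx 0 j).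
by rewrite !(dotvC (delta_mx _ _)) /dotv -!rowE !mxE.
Qed.

(** A form is determined by its values on generators, so Hom(M, R) sits inside a finite free
    module. *)
Lemma dual_fg M : noetherian R -> fg M ->
  exists r (phi : 'I_r -> {linear M -> R^o}), forall psi : {linear M -> R^o},
    exists c : 'I_r -> R, forall x, psi x = \sum_j c j * phi j x.
Proof.
move=> nR [k [g [_ gM]]].
pose S : set 'rV[R]_k := [set u | exists psi : {linear M -> R^o}, u = \row_j psi (g j)].
have sS : submodule S.
  apply/submoduleP; split; first by exists \0; apply/rowP => j; rewrite !mxE.
  move=> a _ _ [f ->] [h ->]; exists (a \*: f \+ h).
  by apply/rowP => j; rewrite !mxE.
have [r [h [Sh hS]]] := @noeth_rV R nR k S sS.
have /choice[phi phiE] := Sh; exists r, phi => psi.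
have [|c cE] := hS (\row_j psi (g j)); first by exists psi.
exists c => x; have [u ->] := gM x I.
rewrite linear_sum; under [RHS]eq_bigr do rewrite linear_sum mulr_sumr.
rewrite exchange_big /=; apply: eq_bigr => j _; rewrite linearZ /=.
have /rowP/(_ j) := cE; rewrite mxE summxE => ->.
rewrite [_ *: _]mulr_sumr; apply: eq_bigr => l _.
by rewrite linearZ /= phiE !mxE [RHS]mulrCA.
Qed.

End LinearForms.

Section Injective.
Variables (R : comNzRingType) (m : set R).
Hypotheses (nR : noetherian R) (lR : local_ring m).
Variables (J : nat -> lmodType R) (dJ : forall k, {linear J k -> J k.+1})
  (e : {linear R^o -> J 1}) (sJ : nat).
Hypotheses (Jinj : forall k, injective_module (J k)) (J0 : forall x : J 0, x = 0)
  (einj : injective e) (eex : forall x, dJ 1 x = 0 <-> exists a, x = e a)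
  (dex : forall k x, dJ k.+2 x = 0 <-> exists y, x = dJ k.+1 y)
  (Jbig : forall k, (sJ < k)%N -> forall x : J k, x = 0).
Implicit Types A B C K M N V W X : lmodType R.

Let dd0 k x : dJ k.+1 (dJ k x) = 0.
Proof.
case: k x => [|k] x; last by apply/dex; exists x.
by rewrite [x]J0 !linear0.
Qed.

(* J is an injective resolution of R shifted by one place, with J 0 = 0, so
   that ext0 i M says that Ext^i(M, R) = 0, also for i = 0. *)
Definition ext0 i M : Prop := forall f : {linear M -> J i.+1},
  (forall x, dJ i.+1 (f x) = 0) -> exists g : {linear M -> J i}, forall x, f x = dJ i (g x).

Lemma ext0_retract n V W (i : {linear V -> W}) (p : {linear W -> V}) :
  cancel i p -> ext0 n W -> ext0 n V.
Proof.
move=> ip eW f f0; have [|g gE] := eW (f \o p); first by move=> x; exact: f0.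
by exists (g \o i) => x; rewrite /= -gE /= ip.
Qed.

Section Ses.
Variables (A B C : lmodType R) (i : {linear A -> B}) (p : {linear B -> C}).
Hypothesis ip : ses i p.

Let extendJ k (f : {linear A -> J k}) :
  exists g : {linear B -> J k}, forall a, g (i a) = f a.
Proof.
by apply: inj_extend => // a ia; have [iinj _ _] := ip; rewrite (lin_inj0 iinj ia) linear0.
Qed.

Let factorC k (f : {linear B -> J k}) : (forall a, f (i a) = 0) ->
  exists g : {linear C -> J k}, forall b, g (p b) = f b.
Proof.
have [_ ex ps] := ip => fi.
by apply: lin_factor => // b /ex[a ->].
Qed.

Lemma ext0_mid n : ext0 n A -> ext0 n C -> ext0 n B.
Proof.
move=> eA eC f f0; have [_ ex ps] := ip.
have [|g gE] := eA (f \o i); first by move=> x; exact: f0.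
have [g' g'E] := extendJ g.
have [|h hE] := factorC (f := f \- (dJ n \o g')).
  by move=> a /=; rewrite g'E -gE /= subrr.
have [|h' h'E] := eC h.
  by move=> c; have [b ->] := ps c; rewrite hE /= linearB f0 dd0 subrr.
exists (g' \+ (h' \o p)) => b; rewrite /= linearD -h'E hE /= addrC subrK //.
Qed.

Lemma ext0_left n : ext0 n B -> ext0 n.+1 C -> ext0 n A.
Proof.
move=> eB eC f f0; have [_ ex ps] := ip.
have [f' f'E] := extendJ f.
have [|q qE] := factorC (f := dJ n.+1 \o f').
  by move=> a /=; rewrite f'E f0.
have [|g gE] := eC q; first by move=> c; have [b ->] := ps c; rewrite qE /= dd0.
have [|h hE] := eB (f' \- (g \o p)).
  by move=> b; rewrite /= linearB -gE qE subrr.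
exists (h \o i) => a; rewrite /= -hE /= (ses_comp0 _ ip) linear0 subr0 f'E //.
Qed.

Lemma ext0_right n : ext0 n A -> ext0 n.+1 B -> ext0 n.+1 C.
Proof.
move=> eA eB f f0; have [_ ex ps] := ip.
have [|g gE] := eB (f \o p); first by move=> b; exact: f0.
have [|h hE] := eA (g \o i).
  by move=> a; rewrite /= -gE /= (ses_comp0 _ ip) linear0.
have [h' h'E] := extendJ h.
have [|q qE] := factorC (f := g \- (dJ n \o h')).
  by move=> a; rewrite /= h'E -hE subrr.
exists q => c; have [b ->] := ps c.
by rewrite qE /= linearB dd0 subr0 -gE.
Qed.

Lemma ext1_of_extend : ext0 1 B ->
  (forall phi : {linear A -> R^o}, exists psi : {linear B -> R^o},
    forall a, psi (i a) = phi a) -> ext0 1 C.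
Proof.
move=> eB H f f0; have [_ ex ps] := ip.
have [|g gE] := eB (f \o p); first by move=> b; exact: f0.
have [phi phiE] : exists phi : {linear A -> R^o}, forall a, e (phi a) = (g \o i) a.
  apply: lin_lift => // a; apply/eex.
  by rewrite /= -gE /= (ses_comp0 _ ip) linear0.
have [psi psiE] := H phi.
have [|q qE] := factorC (f := g \- (e \o psi)).
  by move=> a; rewrite /= psiE phiE subrr.
exists q => c; have [b ->] := ps c.
rewrite qE /= linearB -gE /= [X in _ - X](_ : _ = 0) ?subr0 //.
by apply/eex; exists (psi b).
Qed.

End Ses.

(** The map i may have a kernel, since it will be a matrix; phi factors through its image, whose
    cokernel in B is C. *)
Lemma ext1_extend A B C (i : {linear A -> B}) (p : {linear B -> C})
    (phi : {linear A -> R^o}) :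
  (forall b, p b = 0 <-> exists a, b = i a) -> (forall c, exists b, c = p b) ->
  ext0 1 C -> (forall a, i a = 0 -> phi a = 0) ->
  exists psi : {linear B -> R^o}, forall a, psi (i a) = phi a.
Proof.
move=> ex ps eC phi0.
have [|h hE] := @inj_extend R A B (J 1) i (e \o phi) (@Jinj 1).
  by move=> a /phi0 /= ->; rewrite linear0.
have [q qE] : exists q : {linear C -> J 2}, forall b, q (p b) = (dJ 1 \o h) b.
  apply: lin_factor => // b /ex[a ->]; rewrite /= hE.
  by apply/eex; exists (phi a).
have [|g gE] := eC q; first by move=> c; have [b ->] := ps c; rewrite qE /= dd0.
have [psi psiE] : exists psi : {linear B -> R^o}, forall b, e (psi b) = (h \- (g \o p)) b.
  by apply: lin_lift => // b; apply/eex; rewrite /= linearB -gE qE subrr.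
exists psi => a; apply: einj; rewrite psiE /= hE.
have -> : p (i a) = 0 by apply/ex; exists a.
by rewrite linear0 subr0.
Qed.

Lemma ext0_hom M (phi : {linear M -> R^o}) x : ext0 0 M -> phi x = 0.
Proof.
move=> eM; have [|g gE] := eM (e \o phi); first by move=> y; apply/eex; exists (phi y).
by apply: (lin_inj0 einj); have /= := gE x; rewrite [g x]J0 linear0.
Qed.

Lemma ext0_rV n k : ext0 n.+1 'rV[R]_k.
Proof.
move=> f f0; have /choice[y yE] : forall j, exists y, f (delta_mx 0 j) = dJ n.+1 y.
  by move=> j; apply/dex.
exists (rVlift y : {linear _ -> _}) => u; rewrite rV_linE [RHS]linear_sum.
by apply: eq_bigr => j _; rewrite linearZ /= yE.
Qed.

(** Ext^n(M, R) is finitely generated, by dimension shifting from Hom(-, R); this prepares the use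
    of Nakayama. *)
Lemma ext_fg n M : fg M -> exists r (f : 'I_r -> {linear M -> J n.+1}),
  (forall j x, dJ n.+1 (f j x) = 0) /\
  forall h : {linear M -> J n.+1}, (forall x, dJ n.+1 (h x) = 0) ->
  exists (c : 'I_r -> R) (g : {linear M -> J n}),
    forall x, h x = \sum_j c j *: f j x + dJ n (g x).
Proof.
elim: n M => [|n IH] M fM.
  have [r [phi phiE]] := dual_fg nR fM.
  exists r, (fun j => e \o phi j); split=> [j x|h h0]; first by apply/eex; exists (phi j x).
  have [psi psiE] : exists psi : {linear M -> R^o}, forall x, e (psi x) = h x.
    by apply: lin_lift => // x; apply/eex.
  have [c cE] := phiE psi; exists c, \0 => x.
  rewrite /= linear0 addr0 -psiE cE linear_sum; apply: eq_bigr => j _.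
  by rewrite -[c j * _]/(c j *: (phi j x : R^o)) linearZ.
have [k [a as_]] := (fg_rVP M).1 fM.
have aK := ker_ses as_; have [vinj aex _] := aK.
have [r [f [f0 fE]]] := IH _ (fg_sub nR vinj (fg_rV R k)).
have /choice[F FE] : forall j, exists F : {linear 'rV[R]_k -> J n.+1},
    forall u, F (val u) = f j u.
  move=> j; apply: inj_extend => // u u0.
  by rewrite (lin_inj0 vinj u0) linear0.
have /choice[G GE] : forall j, exists G : {linear M -> J n.+2},
    forall u, G (a u) = dJ n.+1 (F j u).
  move=> j; apply: (lin_factor (f := dJ n.+1 \o F j)) => // u /aex[b ->].
  by rewrite /= FE f0.
exists r, G; split=> [j x|h h0].
  by have [u ->] := as_ x; rewrite GE dd0.
have [|h' h'E] := @ext0_rV n k (h \o a); first by move=> u; exact: h0.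
have [|c [g gE]] := fE (h' \o val).
  by move=> u; rewrite /= -h'E /= (ses_comp0 u aK) linear0.
have [g' g'E] : exists g' : {linear 'rV[R]_k -> J n}, forall u, g' (val u) = g u.
  apply: inj_extend => // u u0.
  by rewrite (lin_inj0 vinj u0) linear0.
have [S SE] := lin_comb c F.
have [q qE] : exists q : {linear M -> J n.+1}, forall u, q (a u) = ((h' \- S) \- (dJ n \o g')) u.
  apply: lin_factor => // u /aex[b ->] /=.
  rewrite g'E SE; have /= -> := gE b; under [X in _ - X - _]eq_bigr do rewrite FE.
  by rewrite addrAC addrK subrr.
exists c, q => x; have [u ->] := as_ x.
under eq_bigr do rewrite GE -linearZ.
rewrite -linear_sum -SE qE /= !linearB dd0 subr0 addrC subrK -h'E //.
Qed.

(** As Ext^{n+1}(N, R) = 0, multiplication by x is onto on the finitely generated module Ext^n(M,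
    R), which is therefore 0. *)
Lemma ext0_regular n M N x (p : {linear M -> N}) : fg M -> m x ->
  ses ( *:%R x : {linear M -> M}) p -> ext0 n.+1 N -> ext0 n M.
Proof.
move=> fM mx xp eN; have [xinj xex ps] := xp.
have [r [f [f0 fE]]] := ext_fg n fM.
(* Injectivity gives h' with h'(x y) = h y; it becomes a cocycle after subtracting a map that
   factors through p, which leaves its values on x M unchanged. *)
have div (h : {linear M -> J n.+1}) : (forall x, dJ n.+1 (h x) = 0) ->
    exists h' : {linear M -> J n.+1}, (forall x, dJ n.+1 (h' x) = 0) /\
      forall y, h y = x *: h' y.
  move=> h0; have [|h' h'E] := @inj_extend R M M _ ( *:%R x) h (@Jinj n.+1).
    by move=> a xa; rewrite (lin_inj0 xinj xa) linear0.
  have [q qE] : exists q : {linear N -> J n.+2}, forall y, q (p y) = (dJ n.+1 \o h') y.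
    apply: lin_factor => // y /xex[a ->]; rewrite /= h'E h0 //.
  have [|g gE] := eN q; first by move=> c; have [b ->] := ps c; rewrite qE /= dd0.
  exists (h' \- (g \o p)); split=> y; first by rewrite /= linearB -gE qE subrr.
  rewrite -linearZ /= -[x *: y]/(( *:%R x : {linear M -> M}) y) h'E.
  by rewrite (ses_comp0 _ xp) linear0 subr0.
pose B : set (M -> J n.+1) := [set h | exists g : {linear M -> J n}, h = dJ n \o g].
have sB : submodule B.
  apply/submoduleP; split; first by exists \0; apply/funext => y; rewrite /= linear0.
  move=> a _ _ [g ->] [g' ->]; exists (a \*: g \+ g').
  by apply/funext => y; rewrite /= linearD linearZ.
have Bf j : B (f j).
  apply: (nakayama nR lR sB (f := fun j => f j : M -> J n.+1)) => {}j.
  have [h [h0 hE]] := div (f j) (f0 j); have [c [g gE]] := fE h h0.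
  exists (fun l => x * c l); first by move=> l; rewrite mulrC; exact: max_idealM.
  exists (x \*: g); apply/funext => y.
  transitivity (f j y - (\sum_l (x * c l) *: (f l : M -> J n.+1)) y) => //.
  rewrite fct_combE.
  rewrite hE gE scalerDr scaler_sumr; under eq_bigr do rewrite scalerA.
  by rewrite addrAC subrr add0r /= linearZ.
move=> h h0; have [c [g gE]] := fE h h0.
have [g' g'E] : B (\sum_j c j *: (f j : M -> J n.+1)) by exact: submodule_sum sB _.
exists (g' \+ g) => y; rewrite gE /= linearD; congr (_ + _).
by rewrite -[RHS]/((dJ n \o g') y) -g'E fct_combE.
Qed.


(** * Bass: Ext(-, R) vanishes above the depth of R *)

Variable F : fres (residue m).
Local Notation dp := (dp F).

Definition injdim_le s : Prop := forall M i, fg M -> (s < i)%N -> ext0 i M.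

Lemma quot_regular M x : injective ( *:%R x : {linear M -> M}) -> fg M ->
  exists N (p : {linear M -> N}), ses ( *:%R x : {linear M -> M}) p /\ fg N.
Proof.
move=> xinj fM; have xp := coker_ses xinj; have [_ _ ps] := xp.
by do 2!eexists; split; [exact: xp|exact: fg_surj ps fM].
Qed.

(** Ischebeck's bound: each regular element on M lowers by one the degree from which Ext(M, R)
    vanishes. *)
Lemma dp_ext0 s t M i : injdim_le s -> fg M -> dp t M -> (s < i + t)%N -> ext0 i M.
Proof.
move=> Hs; elim: t M i => [|t IH] M i fM dM; first by rewrite addn0; exact: Hs.
rewrite addnS -addSn => lt.
have [x mx xinj] := dp1_regular nR lR fM (dp_le (ltn0Sn t) dM).
have [N [p [xp fN]]] := quot_regular xinj fM.
apply: (ext0_regular fM mx xp); apply: IH => //.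
exact (dp_right xp (dp_le (leqnSn t) dM) dM).
Qed.

Lemma injdim_finite : injdim_le sJ.
Proof. by move=> M i _ lt f _; exists \0 => x; rewrite /= linear0; apply: Jbig; exact: leqW. Qed.

(** Depth beyond the length of the injective resolution would give Hom(R, R) = 0 by [dp_ext0]. *)
Lemma depth_ring_finite : exists d, dp d R^o /\ ~ dp d.+1 R^o.
Proof.
have fR : fg (R^o : lmodType R) by exact: noeth_fg (@noeth_ring R nR).
have ndp : ~ dp sJ.+1 R^o.
  move=> dR; have eR : ext0 0 R^o by apply: (dp_ext0 injdim_finite fR dR).
  by have /eqP := ext0_hom idfun (1 : R^o) eR; rewrite oner_eq0.
elim: (sJ.+1) ndp => [|s IH] ndp; first by case: ndp.
by have [dR|/IH//] := pselect (dp s R^o); exists s.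
Qed.

Variable d : nat.
Hypotheses (dR : dp d R^o) (ndR : ~ dp d.+1 R^o).

Lemma dp_rV n : dp d 'rV[R]_n.
Proof. by apply: dp_flat dR; exact: flatlike_rV. Qed.

(** S is R modulo a maximal regular sequence: each of its d elements uses up one unit of depth and
    raises by one the bound above which Ext(S, R) vanishes. *)
Lemma socle_test : exists S, [/\ fg S, socle m S & forall i, (d < i)%N -> ext0 i S].
Proof.
suff H r : forall t S, fg S -> dp r S -> ~ dp r.+1 S ->
    (forall i, (t < i)%N -> ext0 i S) ->
    exists S, [/\ fg S, socle m S & forall i, (t + r < i)%N -> ext0 i S].
  apply: (H d 0%N 'rV[R]_1 (fg_rV R 1) (@dp_rV 1)) => [dS|[//|i _]]; last exact: ext0_rV.
  apply: ndR; apply: (@dp_retract _ _ _ _ R^o 'rV[R]_1 (linmap (@rV_line_linear R 0))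
    (dotv (delta_mx 0 0) : {linear _ -> _}) _ dS) => a.
  by rewrite /= /dotv -scalemxAl mxE trmx_delta mul_delta_mx mxE !eqxx mulr1.
elim: r => [|r IH] t S fS dS ndS eS.
  exists S; split=> // [|i]; last by rewrite addn0; exact: eS.
  by apply: contrapT => nsoc; apply: ndS; apply/dp1_socle.
have [x mx xinj] := dp1_regular nR lR fS (dp_le (ltn0Sn r) dS).
have [N [p [xp fN]]] := quot_regular xinj fS.
rewrite addnS -addSn; apply: (IH t.+1 N) => //.
- exact (dp_right xp (dp_le (leqnSn r) dS) dS).
- by move=> dN; apply: ndS; exact (dp_regular lR mx xp dN).
- case=> // i lt; apply: (ext0_right xp); apply: eS => //.
  exact: ltnW.
Qed.

Lemma socle_residue M : socle m M ->
  exists i : {linear residue m -> M}, injective i.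
Proof.
move=> [z z0 mz].
have lz : linear (fun a : R^o => a *: z) by move=> a u v; rewrite scalerDl scalerA.
have [||i iE] := @lin_factor R R^o (residue m) M (modproj (m : set R^o)) (linmap lz).
- exact: modproj_surj.
- by move=> a /(residue_eq0 lR) /mz.
exists i; apply: lin_inj => y; have [a ->] := modproj_surj y; rewrite iE /= => az.
apply/(residue_eq0 lR); apply: contrapT => /(max_ideal_unit nR lR)[b ba].
by apply: z0; rewrite -[z]scale1r -ba -scalerA az scaler0.
Qed.

(** k embeds in the S of [socle_test], and Ext^{s+1}(k, R) sits between Ext^{s+1}(S, R) = 0 and
    Ext^{s+2}(S/k, R) = 0. *)
Lemma ext0_residue s : injdim_le s.+1 -> (d <= s)%N -> ext0 s.+1 (residue m).
Proof.
move=> Hs ds; have [S [fS socS eS]] := socle_test.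
have [i inj] := socle_residue socS; have ip := coker_ses inj.
apply: (ext0_left ip); first exact: eS.
by apply: Hs => //; apply: fg_surj fS; exact: modproj_surj.
Qed.

(** For a counterexample M take U maximal with Ext^{s+1}(M/U, R) nonzero. A regular element of m on
    M/U contradicts [ext0_regular]; otherwise k embeds in M/U, and the quotient by it is covered by
    maximality. *)
Lemma injdim_step s : injdim_le s.+1 -> (d <= s)%N -> injdim_le s.
Proof.
move=> Hs ds M i fM; rewrite leq_eqVlt => /orP[/eqP <-|lt]; last exact: Hs.
apply: contrapT => neM; pose P (U : set M) := ~ ext0 s.+1 (modquot U).
have sub0 : submodule ([set 0] : set M).
  by apply/submoduleP; split=> // a u v /= -> ->; rewrite scaler0 addr0.
have [||U [sU PU Umax]] := @max_submodule R nR M P [set 0] fM.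
- exact: sub0.
- move=> e0; apply: neM.
  have [||p pE] := @lin_factor R M (modquot ([set 0] : set M)) M (modproj _) idfun.
  + exact: modproj_surj.
  + by move=> u /modproj_eq0E => /(_ sub0).
  exact: ext0_retract pE e0.
have fU : fg (modquot U) by apply: fg_surj fM; exact: modproj_surj.
case: (regular_or_socle nR lR fU) => [[x mx xreg]|soc].
  have [N [p [xp fN]]] := quot_regular (lin_inj (i := *:%R x) xreg) fU.
  by apply: PU; apply: (ext0_regular fU mx xp); exact: Hs.
have [j jinj] := socle_residue soc.
pose U' := [set u : M | exists z, modproj U u = j z].
have sU' : submodule U'.
  apply/submoduleP; split; first by exists 0; rewrite !linear0.
  by move=> a u v [z uz] [w vw]; exists (a *: z + w); rewrite !linearP /= uz vw.
have UU' : U `<=` U'.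
  by move=> u Uu; exists 0; rewrite linear0; apply/modproj_eq0; exact: sub_lspan.
have nU : ~ U' `<=` U.
  move=> U'U; have [u uE] := modproj_surj (j (modproj (m : set R^o) 1)).
  have : j (modproj (m : set R^o) 1) = 0.
    by rewrite uE; apply/modproj_eq0E => //; apply: U'U; exists (modproj (m : set R^o) 1).
  by move=> /(lin_inj0 jinj)/(residue_eq0 lR); exact: max_ideal1.
have eU' : ext0 s.+1 (modquot U').
  by apply: contrapT => PU'; apply: nU; exact: Umax.
have [||p pE] := @lin_factor R M (modquot U) (modquot U') (modproj _) (modproj _).
- exact: modproj_surj.
- by move=> u /modproj_eq0E => /(_ sU)/UU' ?; apply/modproj_eq0E.
apply: PU; apply: (@ext0_mid _ _ _ j p) eU'; last exact: ext0_residue.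
split=> // [b|c]; last first.
  by have [u ->] := modproj_surj c; exists (modproj _ u); rewrite pE.
have [u ->] := modproj_surj b; rewrite pE modproj_eq0E //.
Qed.

Lemma bass : injdim_le d.
Proof.
have H k : injdim_le (k + d) -> injdim_le d.
  elim: k => // k IH Hk; apply: IH; apply: injdim_step; first by rewrite -addSn.
  exact: leq_addl.
apply: (H sJ) => M i fM lt; apply: injdim_finite => //.
by apply: leq_ltn_trans lt; exact: leq_addr.
Qed.

(** ** Maximal Cohen-Macaulay modules are syzygies *)

Definition mcm X : Prop := fg X /\ forall i, ext0 i.+1 X.

Lemma dp_mcm X : fg X -> dp d X -> mcm X.
Proof.
by move=> fX dX; split=> // i; apply: (dp_ext0 bass fX dX); rewrite addSn ltnS leq_addl.
Qed.

Lemma mcm_syzygy X (G : fres X) i K (p : {linear 'rV[R]_(rk G i) -> K}) :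
  mcm X -> (forall z, exists u, z = p u) ->
  (forall u, p u = 0 <-> exists w, u = w *m dmx G i) -> forall n, ext0 n.+1 K.
Proof.
move=> [_ eX]; elim: i K p => [|i IH] K p ps pk n.
  have [f fE] : exists f : {linear K -> X}, forall u, f (p u) = aug G u.
    by apply: lin_factor => // u /pk/aug_ker.
  have [g gE] : exists g : {linear X -> K}, forall u, g (aug G u) = p u.
    by apply: lin_factor => [|u /aug_ker/pk//]; exact: aug_surj.
  apply: (ext0_retract (i := f) (p := g)) (eX n) => z.
  by have [u ->] := ps z; rewrite fE gE.
pose q : {linear 'rV[R]_(rk G i) -> _} := modproj (range (mulmxr (dmx G i))).
have qk u : q u = 0 <-> exists w, u = w *m dmx G i by exact: coker_exact.
have qs z : exists u, z = q u by exact: modproj_surj.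
have [j jE] : exists j : {linear K -> 'rV[R]_(rk G i)},
    forall u, j (p u) = (mulmxr (dmx G i) : {linear _ -> _}) u.
  by apply: lin_factor => // u /pk/dmx_exact.
have jq : ses j q.
  split=> //.
    by apply: lin_inj => z; have [u ->] := ps z; rewrite jE => /dmx_exact/pk.
  move=> u; rewrite qk; split=> [[w ->]|[z ->]]; first by exists (p w); rewrite jE.
  by have [w ->] := ps z; exists w; rewrite jE.
apply: (ext0_left jq); first exact: ext0_rV.
exact: (IH _ q qs qk n.+1).
Qed.

(** u is a form in degree i + 1 that vanishes on the image of the next differential; it extends
    along [dmx G i] because Ext^1 of the i-th syzygy vanishes. *)
Lemma mcm_dual_exact X (G : fres X) i (u : 'rV[R]_(rk G i.+1)) :
  mcm X -> u *m (dmx G i.+1)^T = 0 -> exists w, u = w *m (dmx G i)^T.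
Proof.
move=> mX u0.
have [||||psi psiE] := @ext1_extend _ _ _ (mulmxr (dmx G i))
  (modproj (range (mulmxr (dmx G i)))) (dotv u).
- exact: coker_exact.
- exact: modproj_surj.
- by apply: (@mcm_syzygy X G i) => //; [exact: modproj_surj|exact: coker_exact].
- move=> a /= /dmx_exact[w ->].
  by rewrite dotv_mulmx u0 /dotv trmx0 mulmx0 ?mul0mx mxE.
have [w wE] := dotvP psi; exists w; apply: dotv_inj => v.
rewrite dotvC; have := psiE v; rewrite /= wE => <-.
by rewrite [LHS]dotv_mulmx dotvC.
Qed.

(* The transpose (dual of the presentation matrix) of X is a d-th syzygy of the
   transpose of a syzygy of X, so bass kills its Ext^1(-, R), which is the
   kernel of the biduality map of X. *)
Lemma mcm_torsionless X z : mcm X -> (forall phi : {linear X -> R^o}, phi z = 0) -> z = 0.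
Proof.
move=> mX; have [G] := fres_exists nR mX.1.
pose T i := mulmxr (dmx G i)^T : {linear 'rV[R]_(rk G i) -> 'rV[R]_(rk G i.+1)}.
have fT i : fg (modquot (range (T i))).
  by apply: fg_surj (fg_rV R (rk G i.+1)); exact: modproj_surj.
have eT i n : ext0 n.+1 (modquot (range (T i))).
  suff H k : forall i n, (d < n.+1 + k)%N -> ext0 n.+1 (modquot (range (T i))).
    by apply: (H d); rewrite addSn ltnS leq_addl.
  elim: k => [|k IH] {}i {}n lt; first by apply: bass; rewrite // -[n.+1]addn0.
  have [j jE] : exists j : {linear modquot (range (T i)) -> 'rV[R]_(rk G i.+2)},
      forall u, j (modproj _ u) = T i.+1 u.
    apply: lin_factor; first exact: modproj_surj.
    move=> u u0; have [w ->] := (coker_exact (T i) u).1 u0; rewrite /=.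
    by rewrite -mulmxA -trmx_mul dmx_comp trmx0 mulmx0.
  have jp : ses j (modproj (range (T i.+1))).
    split; last exact: modproj_surj.
      apply: lin_inj => y; have [u ->] := modproj_surj y; rewrite jE /=.
      by move=> /(mcm_dual_exact mX)[w ->]; apply: (coker_exact (T i) _).2; exists w.
    move=> u; rewrite (coker_exact (T i.+1) u); split=> [[w ->]|[y ->]].
      by exists (modproj _ w); rewrite jE.
    by have [w ->] := modproj_surj y; exists w; rewrite jE.
  apply: (ext0_left jp); first exact: ext0_rV.
  by apply: IH; rewrite addSnnS.
have [f ->] := aug_surj G z => phi0.
have [||||psi psiE] := @ext1_extend _ _ _ (T 0%N) (modproj (range (T 0%N))) (dotv f).
- exact: coker_exact.
- exact: modproj_surj.
- exact: eT.
(* A vector killed by [T 0] is a form on X; all forms kill z, so [dotv f] vanishes on the kernel of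
   [T 0]. *)
- move=> a /= a0.
  have [||chi chiE] := @lin_factor R _ X R^o (aug G) (dotv a).
  + exact: aug_surj.
  + by move=> u /aug_ker[w ->]; rewrite /= dotv_mulmx a0 /dotv trmx0 mulmx0 ?mul0mx mxE.
  by rewrite dotvC -chiE.
have [w wE] := dotvP psi; apply/aug_ker; exists w; apply: dotv_inj => v.
rewrite dotvC; have := psiE v; rewrite /= wE => <-.
by rewrite [LHS]dotv_mulmx trmxK dotvC.
Qed.

(** The coordinates of the embedding generate Hom(X, R), so every form on X extends to the free
    module; this gives Ext^1(C, R) = 0. *)
Lemma mcm_embed X : mcm X -> exists g (j : {linear X -> 'rV[R]_g}) C
  (q : {linear 'rV[R]_g -> C}), ses j q /\ mcm C.
Proof.
move=> mX; have [r [phi phiE]] := dual_fg nR mX.1.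
have lj : linear (fun x => \row_k phi k x).
  by move=> a u v; apply/rowP => k; rewrite !mxE linearP.
have jinj : injective (linmap lj).
  apply: lin_inj => x /= /rowP x0; apply: (mcm_torsionless mX) => psi.
  have [c ->] := phiE psi; rewrite big1 // => k _.
  by have := x0 k; rewrite !mxE => ->; rewrite mulr0.
have jq := coker_ses jinj; do 4!eexists; split; first exact: jq.
split; first by apply: fg_surj (fg_rV R r); exact: modproj_surj.
case=> [|i]; last by apply: (ext0_right jq); [exact: mX.2|exact: ext0_rV].
apply: (ext1_of_extend jq); first exact: ext0_rV.
move=> psi; have [c cE] := phiE psi.
exists (dotv (\row_k c k) : {linear _ -> _}) => x.
rewrite cE /= /dotv mxE; apply: eq_bigr => k _.
by rewrite !mxE mulrC.
Qed.

(** Cokernels of embeddings are again of this kind, and depth t of C gives depth t + 1 of X as long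
    as t < d. *)
Lemma mcm_dp X : mcm X -> dp d X.
Proof.
suff H t : (t <= d)%N -> forall X, mcm X -> dp t X by exact: H.
elim: t => [|t IH] td {}X mX; first by [].
have [g [j [C [q [jq mC]]]]] := mcm_embed mX.
apply: (dp_left jq); first exact: IH (ltnW td) _ mC.
exact: dp_le td (@dp_rV g).
Qed.

(** Depth above d makes Hom(X, R) vanish, while X is torsionless. *)
Lemma depth_le X : fg X -> dp d.+1 X -> forall x : X, x = 0.
Proof.
move=> fX dX x; apply: (mcm_torsionless (dp_mcm fX (dp_le (leqnSn d) dX))) => phi.
by apply: ext0_hom; apply: (dp_ext0 bass fX dX).
Qed.

End Injective.

Lemma gorenstein_depth (R : comNzRingType) (m : set R) (F : fres (residue m)) :
  gorenstein_local m -> exists d,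
  [/\ dp F d R^o, ~ dp F d.+1 R^o,
      forall X : lmodType R, fg X -> dp F d X ->
        exists g (j : {linear X -> 'rV[R]_g}) (C : lmodType R) (q : {linear 'rV[R]_g -> C}),
        [/\ ses j q, fg C & dp F d C] &
      forall X : lmodType R, fg X -> dp F d.+1 X -> forall x : X, x = 0].
Proof.
move=> [nR lR [n [I [e [dI [Iinj einj eex dex Ibig]]]]]].
pose J k : lmodType R := if k is k'.+1 then I k' else 'rV[R]_0.
pose dJ k : {linear J k -> J k.+1} :=
  match k with 0 => (\0 : {linear 'rV[R]_0 -> I 0%N}) | k'.+1 => dI k' end.
have Jinj k : injective_module (J k).
  case: k => [|k]; last exact: Iinj.
  move=> A B i f _; exists \0 => x; apply/rowP => -[] //.
have J0 (x : J 0%N) : x = 0 by apply/rowP => -[].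
have eex' x : dJ 1%N x = 0 <-> exists a, x = e a.
  split=> [x0|[a ->]]; last by have : range e (e a) by [exists a]; rewrite eex.
  have : [set x | dI 0%N x = 0] x by [].
  by rewrite -eex => -[a _ <-]; exists a.
have dex' k x : dJ k.+2 x = 0 <-> exists y, x = dJ k.+1 y.
  split=> [x0|[a ->]]; last by have : range (dI k) (dI k a) by [exists a]; rewrite dex.
  have : [set x | dI k.+1 x = 0] x by [].
  by rewrite -dex => -[a _ <-]; exists a.
have Jbig k : (n.+1 < k)%N -> forall x : J k, x = 0.
  case: k => // k /Ibig nz x; apply: contrapT => x0; apply: nz.
  by exists x; apply/eqP.
have [d [dR ndR]] := depth_ring_finite nR lR Jinj J0 einj eex' dex' Jbig F.
exists d; split=> // [X fX dX|X fX dX]; last first.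
  exact: (depth_le nR lR Jinj J0 einj eex' dex' Jbig dR ndR fX dX).
have mX := dp_mcm nR lR Jinj J0 einj eex' dex' Jbig dR ndR fX dX.
have [g [j [C [q [jq mC]]]]] := mcm_embed nR lR Jinj J0 einj eex' dex' Jbig dR ndR mX.
exists g, j, C, q; split=> //; first by case: mC.
exact (mcm_dp nR lR Jinj J0 einj eex' dex' Jbig dR ndR mC).
Qed.

(** * Tensor products *)

Section Tensor.
Variable R : comNzRingType.
Implicit Types A B C K L M N V W X : lmodType R.

Lemma tens_linl M N (y : N) : linear (fun x : M => tens x y).
Proof.
move=> a u v; apply/eqP; rewrite -subr_eq0 opprD addrA /tens -linearZ -!linearB.
apply/eqP/modproj_eq0; apply: sub_lspan; left.
by exists a, u, v, y.
Qed.

Lemma tens_linr M N (x : M) : linear (fun y : N => tens x y).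
Proof.
move=> a u v; apply/eqP; rewrite -subr_eq0 opprD addrA /tens -linearZ -!linearB.
apply/eqP/modproj_eq0; apply: sub_lspan; right.
by exists a, x, u, v.
Qed.

Definition tensl M N (y : N) : {linear M -> tensor M N} := linmap (tens_linl y).
Definition tensr M N (x : M) : {linear N -> tensor M N} := linmap (tens_linr x).
Arguments tensl {M N} y.
Arguments tensr {M N} x.

Lemma tensZl M N a (x : M) (y : N) : tens (a *: x) y = a *: tens x y.
Proof. by rewrite -[LHS]/(tensl y (a *: x)) linearZ. Qed.

Lemma tensZr M N a (x : M) (y : N) : tens x (a *: y) = a *: tens x y.
Proof. by rewrite -[LHS]/(tensr x (a *: y)) linearZ. Qed.

Lemma tensorind M N (S : set (tensor M N)) : submodule S ->
  (forall x y, S (tens x y)) -> forall z, S z.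
Proof.
move=> sS St z; have [w ->] := modproj_surj z; have [S0 SL] := (submoduleP S).1 sS.
rewrite -[w]freeg_sumE raddf_sum /=; elim/big_rec: _ => // p v _ Sv.
have -> : << coeff p w *g p >> = coeff p w *: << p >> :> {freeg (M * N)%type / R}.
  by apply/eqP/freeg_eqP => x; rewrite coeffZ !coeffU mul1r.
rewrite linearZ; apply: SL => //; case: p => x y.
exact: St.
Qed.

Lemma tensor_ext M N W (f g : {linear tensor M N -> W}) :
  (forall x y, f (tens x y) = g (tens x y)) -> forall z, f z = g z.
Proof.
move=> fg; apply: tensorind => //; apply/submoduleP; split=> [|a u v /= fu fv].
  by rewrite /= !linear0.
by rewrite !linearP fu fv.
Qed.

Lemma tensor_lift M N W (h : M -> N -> W) :
  (forall y, linear (h^~ y)) -> (forall x, linear (h x)) ->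
  exists g : {linear tensor M N -> W}, forall x y, g (tens x y) = h x y.
Proof.
move=> hl hr.
have [f fE] : exists f : {linear {freeg (M * N)%type / R} -> W},
    forall x y, f (tensor_pair x y) = h x y.
  exists (free_lift (fun p : M * N => h p.1 p.2) : {linear _ -> _}) => x y.
  exact: free_liftU.
have [||g gE] := @lin_factor R _ (tensor M N) W (modproj (@tensor_rel R M N)) f.
- exact: modproj_surj.
- move=> a /modproj_eq0; move: a; apply: (@lspan_min R _ _ [set z | f z = 0]).
    apply/submoduleP; split=> [|a u v /= fu fv]; first by rewrite /= linear0.
    by rewrite linearP fu fv scaler0 addr0.
  move=> z [[a [x [x' [y ->]]]]|[a [x [y [y' ->]]]]];
    rewrite /= !linearB linearZ /= !fE ?hl ?hr.
    by rewrite addrAC addrK subrr.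
  by rewrite addrAC addrK subrr.
by exists g => x y; rewrite /tens gE fE.
Qed.

Lemma tensor_map_ext M M' N (f : {linear M -> M'}) (g : {linear tensor M N -> tensor M' N}) :
  (forall x y, g (tens x y) = tens (f x) y) -> forall z, tensor_map N f z = g z.
Proof.
move=> gE; apply: (tensor_ext (f := tensor_map N f)) => x y.
by rewrite gE; exact: tensor_mapE.
Qed.

Lemma tensor_map_comp M M' M'' N (f : {linear M -> M'}) (g : {linear M' -> M''}) z :
  tensor_map N (g \o f : {linear M -> M''}) z = tensor_map N g (tensor_map N f z).
Proof.
apply: (tensor_map_ext (g := (tensor_map N g \o tensor_map N f : {linear _ -> _}))).
by move=> x y; rewrite /= !tensor_mapE.
Qed.

Lemma tensor_map_eq M M' N (f g : {linear M -> M'}) z :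
  f =1 g -> tensor_map N f z = tensor_map N g z.
Proof.
by move=> fg; apply: tensor_map_ext => x y; rewrite fg; exact: tensor_mapE.
Qed.

Lemma tensor_map_scale M N a z :
  tensor_map N ( *:%R a : {linear M -> M}) z = a *: z.
Proof.
apply: (tensor_map_ext (g := ( *:%R a : {linear tensor M N -> _}))) => x y.
by rewrite /= tensZl.
Qed.

Lemma tensor_comm M N : exists (f : {linear tensor M N -> tensor N M})
  (g : {linear tensor N M -> tensor M N}), cancel f g /\ cancel g f.
Proof.
have [f fE] := @tensor_lift M N (tensor N M) (fun x y => tens y x)
  (fun y => tens_linr y) (fun x => tens_linl x).
have [g gE] := @tensor_lift N M (tensor M N) (fun x y => tens y x)
  (fun y => tens_linr y) (fun x => tens_linl x).
exists f, g; split.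
  by apply: (tensor_ext (f := g \o f) (g := idfun)) => x y; rewrite /= fE gE.
by apply: (tensor_ext (f := f \o g) (g := idfun)) => x y; rewrite /= gE fE.
Qed.

Section Presentation.
Variables (N : lmodType R) (G : fres N).

Local Notation gen j := (aug G (delta_mx 0 j)).

Definition tsum M (v : 'I_(rk G 0) -> M) : tensor M N := \sum_j tens (v j) (gen j).

Fact tsum_linear M : linear (@tsum M).
Proof.
move=> a u v; rewrite /tsum scaler_sumr -big_split; apply: eq_bigr => j _.
exact: (tens_linl (gen j) a (u j) (v j)).
Qed.
HB.instance Definition _ M :=
  GRing.isLinear.Build R ('I_(rk G 0) -> M) (tensor M N) _ (@tsum M) (@tsum_linear M).

Lemma tens_tsum M (x : M) (u : 'rV[R]_(rk G 0)) :
  tens x (aug G u) = tsum (fun j => u 0 j *: x).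
Proof.
rewrite rV_linE -[LHS]/(tensr x _) linear_sum; apply: eq_bigr => j _.
by rewrite linearZ /= tensZl.
Qed.

Lemma tsum_surj M (z : tensor M N) : exists v, z = tsum v.
Proof.
move: z; apply: tensorind.
  apply/submoduleP; split; first by exists 0; rewrite linear0.
  by move=> a _ _ [u ->] [v ->]; exists (a *: u + v); rewrite linearP.
by move=> x y; have [u ->] := aug_surj G y; eexists; exact: tens_tsum.
Qed.

Lemma tensor_map_tsum M M' (f : {linear M -> M'}) v :
  tensor_map N f (tsum v) = tsum (f \o v).
Proof.
by rewrite /tsum linear_sum; apply: eq_bigr => j _; rewrite /= tensor_mapE.
Qed.

Lemma tsum_mact M n (A : 'M[R]_(rk G 0, n)) (w : 'I_n -> M) :
  tsum (mact A w) = \sum_l tens (w l) (aug G (row l A^T)).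
Proof.
rewrite /tsum /mact; under eq_bigr do rewrite -[tens _ _]/(tensl _ _) linear_sum.
rewrite exchange_big /=; apply: eq_bigr => l _.
rewrite (rV_linE (aug G)) -[RHS]/(tensr _ _) linear_sum; apply: eq_bigr => j _.
by rewrite /= tensZl tensZr !mxE.
Qed.

(** M ox N is the cokernel of the presentation matrix of N on powers of M. The inverse map uses
    chosen coordinates c y of y; it is bilinear because another choice changes its value only by the
    image of the matrix. *)
Lemma tsum_eq0 M v : tsum v = 0 <-> exists w : 'I_(rk G 1) -> M, v = mact (dmx G 0)^T w.
Proof.
split=> [v0|[w ->]]; last first.
  rewrite tsum_mact big1 // => l _; rewrite trmxK.
  have -> : aug G (row l (dmx G 0)) = 0.
    by apply/aug_ker; exists (delta_mx 0 l); rewrite -rowE.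
  exact: (linear0 (tensr (w l))).
pose S : set ('I_(rk G 0) -> M) := range (mact (dmx G 0)^T (W := M)).
have sS : submodule S by exact: range_submodule.
have /choice[c cE] := aug_surj G.
pose h (x : M) (y : N) : modquot S := modproj S (fun j => c y 0 j *: x).
have hE x u : h x (aug G u) = modproj S (fun j => u 0 j *: x).
  apply/eqP; rewrite -subr_eq0 -linearB; apply/eqP/modproj_eq0E => //.
  have [|w wE] := (@aug_ker _ _ G (c (aug G u) - u)).1.
    by rewrite linearB -cE subrr.
  exists (fun l => w 0 l *: x) => //; apply/funext => j.
  transitivity ((c (aug G u) - u) 0 j *: x); last by rewrite !mxE scalerBl.
  rewrite wE mxE scaler_suml; apply: eq_bigr => l _.
  by rewrite !mxE scalerA mulrC.
have [||g gE] := @tensor_lift M N (modquot S) h.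
- move=> y a x x'; rewrite /h -linearP; congr (modproj S _); apply/funext => j.
  transitivity (a *: (c y 0 j *: x) + c y 0 j *: x') => //.
  by rewrite scalerDr !scalerA mulrC.
- move=> x a y y'; rewrite [y]cE [y']cE -linearP !hE -linearP; congr (modproj S _).
  apply/funext => j; rewrite !mxE.
  transitivity (a *: (c y 0 j *: x) + c y' 0 j *: x) => //.
  by rewrite scalerDl scalerA.
have : g (tsum v) = modproj S v.
  rewrite /tsum linear_sum; under eq_bigr do rewrite gE hE.
  rewrite -raddf_sum; congr (modproj S _); apply/funext => j.
  rewrite fct_sumE (bigD1 j) //= mxE !eqxx scale1r big1 ?addr0 // => l /negPf lj.
  by rewrite mxE eq_sym lj andbF scale0r.
rewrite v0 linear0 => /esym/(modproj_eq0E _ sS)[w _ <-].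
by exists w.
Qed.

Lemma tensor_map_surj M M' (f : {linear M -> M'}) : (forall y, exists x, y = f x) ->
  forall z, exists w, z = tensor_map N f w.
Proof.
move=> fs z; have [v ->] := tsum_surj z; have [u ->] := surj_pow v fs.
by exists (tsum u); rewrite tensor_map_tsum.
Qed.

Lemma tensor_map_exact A B C (i : {linear A -> B}) (p : {linear B -> C}) :
  (forall b, p b = 0 <-> exists a, b = i a) -> (forall c, exists b, c = p b) ->
  forall z, tensor_map N p z = 0 <-> exists w, z = tensor_map N i w.
Proof.
move=> ex ps z; split=> [|[w ->]]; last first.
  have [v ->] := tsum_surj w; rewrite !tensor_map_tsum (_ : p \o _ = 0) ?linear0 //.
  by apply/funext => j /=; apply/ex; exists (v j).
have [v ->] := tsum_surj z; rewrite tensor_map_tsum => /tsum_eq0[w' w'E].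
have [w wE] := surj_pow w' ps.
have /choice[u uE] : forall j, exists a, (v - mact (dmx G 0)^T w) j = i a.
  move=> j; apply/ex; have := congr1 (@^~ j) w'E; rewrite wE -mact_map /= => pv.
  by transitivity (p (v j) - p (mact (dmx G 0)^T w j)); [exact: linearB|rewrite pv subrr].
exists (tsum u); rewrite tensor_map_tsum.
have -> : i \o u = v - mact (dmx G 0)^T w by apply/funext => j; rewrite [RHS]uE.
rewrite linearB /= [X in _ - X](_ : _ = 0) ?subr0 //.
by apply/tsum_eq0; exists w.
Qed.

Lemma fg_tensor M : fg M -> fg (tensor M N).
Proof.
move=> [n [g [_ gM]]]; set k := rk G 0.
pose f (u : 'rV[R]_(k * n)) : tensor M N :=
  tsum (fun j => \sum_l vec_mx u j l *: g l).
have lf : linear f.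
  move=> a u v; rewrite /f -linearP; congr (tsum _); apply/funext => j.
  transitivity (a *: (\sum_l vec_mx u j l *: g l) + \sum_l vec_mx v j l *: g l) => //.
  rewrite scaler_sumr -big_split; apply: eq_bigr => l _.
  by rewrite linearP !mxE scalerDl scalerA.
apply: (@fg_surj _ _ _ (linmap lf)); last exact: fg_rV.
move=> z; have [v ->] := tsum_surj z.
have /choice[c cE] : forall j, exists c : 'I_n -> R, v j = \sum_l c l *: g l.
  by move=> j; exact: gM.
exists (mxvec (\matrix_(j, l) c j l)); rewrite /= /f mxvecK; congr (tsum _).
by apply/funext => j; rewrite cE; apply: eq_bigr => l _; rewrite mxE.
Qed.

(** ** Vanishing of Tor *)

(** Degrees are off by one: this is Tor_{i+1}(M, N) = 0. *)
Definition tor0 i M : Prop := exact (dmx G i)^T (dmx G i.+1)^T M.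

Lemma dmx_trcomp i : (dmx G i)^T *m (dmx G i.+1)^T = 0.
Proof. by rewrite -trmx_mul dmx_comp trmx0. Qed.

Lemma tor0_flat i W : flatlike W -> tor0 i W.
Proof.
apply=> v v0; have [|w wE] := (@dmx_exact _ _ G i (\row_j (v j : R))).1.
  apply/rowP => l; rewrite mxE [RHS]mxE.
  rewrite -[RHS]/((0 : 'I_(rk G i) -> R^o) l) -v0 /mact; apply: eq_bigr => j _.
  by rewrite !mxE [LHS]mulrC.
exists (fun j => w 0 j); apply/funext => j; have /rowP/(_ j) := wE.
rewrite mxE => ->; rewrite mxE; apply: eq_bigr => l _.
by rewrite !mxE [LHS]mulrC.
Qed.

Section TorSes.
Variables (A B C : lmodType R) (i : {linear A -> B}) (p : {linear B -> C}).
Hypothesis ip : ses i p.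

Lemma tor0_mid n : tor0 n A -> tor0 n C -> tor0 n B.
Proof. exact (exact_mid ip (dmx_trcomp n)). Qed.

Lemma tor0_right n : tor0 n.+1 B -> tor0 n A -> tor0 n.+1 C.
Proof. exact (exact_right ip (dmx_trcomp n)). Qed.

Lemma tor0_left n : tor0 n.+1 C -> tor0 n B -> tor0 n A.
Proof. exact (exact_left ip (dmx_trcomp n.+1)). Qed.

Lemma tor0_inj : tor0 0 C -> injective (tensor_map N i).
Proof.
move=> tC; have [iinj ex ps] := ip.
apply: (lin_inj (i := tensor_map N i)) => z; have [v ->] := tsum_surj z.
rewrite /= tensor_map_tsum => /tsum_eq0[w wE].
have [|w' w'E] := tC (p \o w); first by rewrite -mact_map -wE (ses_pow0 ip).
have [w'' w''E] := surj_pow w' ps.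
have [u uE] : exists u, w - mact (dmx G 1)^T w'' = i \o u.
  by apply: (ses_pow ip); rewrite compfB mact_map -w''E w'E subrr.
apply/tsum_eq0; exists u; apply: (inj_pow iinj).
by rewrite mact_map -uE linearB /= mact_comp dmx_trcomp mact0mx subr0 wE.
Qed.

Lemma inj_tor0 : tor0 0 B -> injective (tensor_map N i) -> tor0 0 C.
Proof.
move=> tB inj v v0; have [iinj ex ps] := ip.
have [v' v'E] := surj_pow v ps.
have [u uE] : exists u, mact (dmx G 0)^T v' = i \o u.
  by apply: (ses_pow ip); rewrite mact_map -v'E.
have /tsum_eq0[u' u'E] : tsum u = 0.
  apply: inj; rewrite tensor_map_tsum -uE -[RHS]/(tensor_map N i 0) linear0.
  by apply/tsum_eq0; exists v'.
have [|w wE] := tB (v' - (i \o u' : 'I_(rk G 1) -> B)).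
  by rewrite linearB /= uE u'E mact_map subrr.
by exists (p \o w); rewrite -mact_map -wE compfB -v'E (ses_pow0 ip) subr0.
Qed.

End TorSes.

End Presentation.
End Tensor.

Arguments tensl {R M N} y.
Arguments tensr {R M N} x.

(** * Canonical Tor compared with Tor computed by matrices *)

Section TorVanishing.
Variable R : comNzRingType.
Implicit Types A B C K L M N U V W X : lmodType R.

Lemma homology_eq0 U V W (f : {linear U -> V}) (g : {linear V -> W}) :
  ~ nonzero (homology f g) <-> forall z, g z = 0 -> exists w, z = f w.
Proof.
pose S := [set z : ker g | range f (val z)].
have sS : submodule S.
  apply/submoduleP; split; first by exists 0; rewrite ?linear0.
  move=> a u v [x _ xu] [y _ yv]; exists (a *: x + y) => //.
  by rewrite linearP xu yv.
split=> [nz z gz|H [c]].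
  have zk : z \in ker_pred g by apply/eqP.
  have : S (Ker zk).
    apply/(modproj_eq0E _ sS); apply: contrapT => z0; apply: nz.
    by exists (modproj S (Ker zk)); apply/eqP.
  by move=> [w _ /= <-]; exists w.
have [z ->] := modproj_surj c; case/eqP; apply/(modproj_eq0E _ sS).
by have [|w wE] := H (val z); [exact/eqP/(valP z)|exists w].
Qed.

Lemma free_cover_surj L (x : L) : exists w, x = free_cover L w.
Proof. by exists << x >>; rewrite [RHS]free_liftU. Qed.

Lemma syz_ses M j :
  ses (val : ker (free_cover (syz M j)) -> free_res M j) (free_cover (syz M j)).
Proof. exact: ker_ses (@free_cover_surj _). Qed.

Variables (N : lmodType R) (G : fres N).

Lemma Tor_succ_eq0 M j : ~ nonzero (Tor M j.+1 N) <->
  injective (tensor_map N (val : ker (free_cover (syz M j)) -> free_res M j)).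
Proof.
have dE i z : tensor_map N (res_diff M i) z =
    tensor_map N (val : ker (free_cover (syz M i)) -> free_res M i)
      (tensor_map N (free_cover (syz M i.+1)) z).
  exact: tensor_map_comp.
have [_ ex _] := syz_ses M j.+1.
have tex := tensor_map_exact G ex (@free_cover_surj (syz M j.+1)).
rewrite homology_eq0; split=> [H|inj z].
  apply: (lin_inj (i := tensor_map N _)) => y y0.
  have [z yE] := tensor_map_surj G (@free_cover_surj (syz M j.+1)) y.
  have [|w wE] := H z; first by move: y0; rewrite yE => y0; rewrite /= dE.
  rewrite yE; apply/tex; exists (tensor_map N (free_cover (syz M j.+2)) w).
  by rewrite wE; exact: dE.
rewrite /= dE => /(lin_inj0 (i := tensor_map N _) inj)/tex[w ->].
have [w' ->] := tensor_map_surj G (@free_cover_surj (syz M j.+2)) w.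
by exists w'; rewrite /= dE.
Qed.

(** Both conditions are shifted along the canonical syzygies of M down to Tor_1, where each says
    that the inclusion of a syzygy in its free module stays injective after ox N. *)
Lemma Tor_tor0 M : (forall i, ~ nonzero (Tor M i.+1 N)) <-> forall i, tor0 G i M.
Proof.
have fl j : flatlike (free_res M j) by exact: flatlike_freeg.
split=> [H i|H j].
  suff {i} T i j : tor0 G i (syz M j) by exact: (T i 0%N).
  elim: i j => [|i IH] j.
    apply: (inj_tor0 (syz_ses M j)); first by apply: tor0_flat; exact: fl.
    exact/Tor_succ_eq0.
  by apply: (tor0_right (syz_ses M j)); [apply: tor0_flat; exact: fl|exact: (IH j.+1)].
have T : forall i, tor0 G i (syz M j).
  elim: j => [//|j IH] i; apply: (tor0_left (syz_ses M j)) (IH i.+1) _.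
  by apply: tor0_flat; exact: fl.
by apply/Tor_succ_eq0; exact: (tor0_inj (syz_ses M j) (T 0%N)).
Qed.

Lemma Tor_0_nonzero M : nonzero (Tor M 0 N) <-> nonzero (tensor M N).
Proof.
suff H : ~ nonzero (Tor M 0 N) <-> ~ nonzero (tensor M N).
  by split=> nz; apply: contrapT => /H.
have [_ ex _] := syz_ses M 0.
have tex := tensor_map_exact G ex (@free_cover_surj (syz M 0)).
have dE z : tensor_map N (res_diff M 0) z =
    tensor_map N (val : ker (free_cover (syz M 0)) -> free_res M 0)
      (tensor_map N (free_cover (syz M 1)) z).
  exact: tensor_map_comp.
rewrite homology_eq0; split=> [H [y /eqP]|H z _].
  have [z ->] := tensor_map_surj G (@free_cover_surj (syz M 0)) y; apply.
  by have [//|w ->] := H z; apply/tex; eexists; exact: dE.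
have [|w ->] := (tex z).1.
  by apply: contrapT => z0; apply: H; eexists; apply/eqP; exact: z0.
have [w' ->] := tensor_map_surj G (@free_cover_surj (syz M 1)) w.
by exists w'; rewrite /= dE.
Qed.

(** If all Tor vanished the supremum would be -oo, so the value 0 also records that M ox N is
    nonzero. *)
Lemma q_TorP M : q_Tor M N = 0%E <->
  (forall i, tor0 G i M) /\ nonzero (tensor M N).
Proof.
rewrite -Tor_tor0 -Tor_0_nonzero /q_Tor; set S := (X in supremum _ X).
split=> [S0|[T nz]].
  have ub x : S x -> (x <= 0)%E.
    move=> Sx; move: S0; rewrite /supremum; case: eqP => [S0|_].
      by move: Sx; rewrite S0.
    by case: xgetP => [y -> [yub _] <-|//]; exact: yub.
  have pos i : nonzero (Tor M i N) -> i = 0%N.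
    move=> nz; have /ub : S (i%:Z)%:E%E by exists i.
    by rewrite lee_fin lez_nat leqn0 => /eqP.
  split=> [i /pos //|]; apply: contrapT => nz.
  have SE : S = set0.
    apply/seteqP; split=> // x [i nzi _]; apply: nz.
    by rewrite -(pos i nzi).
  by move: S0; rewrite SE supremum0.
suff -> : S = [set 0%E] by rewrite supremum1.
apply/seteqP; split=> [x [[|i] nzi <-] //|x ->]; first by case: (T i).
by exists 0%N.
Qed.

End TorVanishing.

(** * Symmetry of Tor-independence *)

Section Swap.
Variable R : comNzRingType.
Implicit Types A B C K L M N U V W X : lmodType R.

Lemma row_vectors p q (v : 'I_p -> 'rV[R]_q) : exists X : 'M[R]_(p, q), forall j, v j = row j X.
Proof. by exists (\matrix_j v j) => j; rewrite rowK. Qed.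

Lemma mact_rows p q r (A : 'M[R]_(p, q)) (X : 'M[R]_(q, r)) j :
  mact A (fun l => row l X) j = row j (A *m X).
Proof.
by rewrite /mact row_mul mulmx_sum_row; apply: eq_bigr => l _; rewrite mxE.
Qed.

Lemma mact_aug K (G : fres K) p q (A : 'M[R]_(p, q)) (X : 'M[R]_(q, rk G 0)) j :
  mact A (fun l => aug G (row l X)) j = aug G (row j (A *m X)).
Proof.
rewrite -mact_rows /mact linear_sum; apply: eq_bigr => l _.
by rewrite linearZ.
Qed.

(* Both tor0 G i M and tor0 H 0 of the i-th syzygy of N say that
   X *m dmx G i = (dmx H 0)^T *m Y implies X = (dmx H 0)^T *m Z + Z' *m dmx G i.+1. *)
Lemma tor0_swap M N (G : fres N) (H : fres M) :
  (forall i, tor0 G i M) -> forall i, tor0 H i N.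
Proof.
move=> T.
have cond i (X : 'M[R]_(rk H 0, rk G i.+1)) Y :
    X *m dmx G i = (dmx H 0)^T *m Y ->
    exists Z Z', X = (dmx H 0)^T *m Z + Z' *m dmx G i.+1.
  move=> XY; have [|w wE] := T i (fun l => aug H (row l X^T)).
    apply/funext => l; rewrite mact_aug -trmx_mul XY trmx_mul trmxK.
    by apply/aug_ker; exists (row l Y^T); rewrite row_mul.
  have /choice[z zE] := fun l => aug_surj H (w l).
  have [Z' Z'E] := row_vectors z.
  have /choice[y yE] : forall l, exists y, row l (X^T - (dmx G i.+1)^T *m Z') = y *m dmx H 0.
    move=> l; apply/aug_ker; rewrite linearB linearB /= -mact_aug.
    have /= -> := congr1 (@^~ l) wE; apply/eqP; rewrite subr_eq0; apply/eqP.
    by congr (mact _ _ l); apply/funext => k; rewrite zE Z'E.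
  have [Z ZE] := row_vectors y; exists Z^T, Z'^T.
  apply: trmx_inj; rewrite linearD /= !trmx_mul !trmxK; apply/eqP.
  rewrite -subr_eq; apply/eqP/row_matrixP => l.
  by rewrite yE row_mul -ZE.
(* K is the i-th syzygy of N. The induction on n treats all i at once, since Tor_{n+2} of K is
   Tor_{n+1} of the next syzygy; [cond] enters for n = 0. *)
have base i K (p : {linear 'rV[R]_(rk G i) -> K}) : (forall z, exists u, z = p u) ->
    (forall u, p u = 0 <-> exists w, u = w *m dmx G i) -> forall n, tor0 H n K.
  move=> ps pk n; elim: n i K p ps pk => [|n IH] i K p ps pk.
    move=> v v0; have /choice[x xE] := fun l => ps (v l).
    have [X0 X0E] := row_vectors x.
    have vE : v = p \o (fun l => row l X0) by apply/funext => l /=; rewrite -X0E.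
    have /choice[y yE] : forall l, exists y, row l ((dmx H 0)^T *m X0) = y *m dmx G i.
      move=> l; apply/pk; rewrite -mact_rows.
      transitivity (mact (dmx H 0)^T v l); last by rewrite v0.
      by rewrite vE -mact_map.
    have [X1 X1E] := row_vectors y.
    have XE : X1 *m dmx G i = (dmx H 0)^T *m X0.
      by apply/row_matrixP => l; rewrite row_mul -X1E yE.
    have [Z [Z' ZE]] := cond i X1 X0 XE.
    have [|w wE] := @tor0_flat _ _ H 0 'rV[R]_(rk G i) (@flatlike_rV R _)
        (fun l => row l (X0 - Z *m dmx G i)).
      apply/funext => l; rewrite mact_rows mulmxBr mulmxA -XE ZE mulmxDl -!mulmxA.
      by rewrite dmx_comp mulmx0 addr0 subrr row0.
    exists (p \o w); rewrite -mact_map -wE vE; apply/funext => l /=.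
    rewrite !linearB /= [X in _ - X](_ : _ = 0) ?subr0 //.
    by apply/pk; exists (row l Z); rewrite row_mul.
  have kp := ker_ses ps; have [vinj kex _] := kp.
  have [p' p'E] : exists p' : {linear 'rV[R]_(rk G i.+1) -> ker p},
      forall u, (val : ker p -> _) (p' u) = (mulmxr (dmx G i) : {linear _ -> _}) u.
    apply: (lin_lift (i := (val : ker p -> 'rV[R]_(rk G i)))) => // u.
    by apply/kex/pk; exists u.
  apply: (tor0_right kp); first by apply: tor0_flat; exact: flatlike_rV.
  apply: (IH i.+1 _ p') => [z|u].
    have [|w wE] := (pk (val z)).1; first exact/eqP/(valP z).
    by exists w; apply: val_inj; rewrite p'E.
  rewrite -dmx_exact -[u *m _]/((mulmxr (dmx G i) : {linear _ -> _}) u) -p'E.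
  by split=> [->|/(lin_inj0 (i := (val : ker p -> _)) vinj)//]; rewrite linear0.
exact: (base 0%N N (aug G) (aug_surj G) (@aug_ker _ _ G)).
Qed.

End Swap.


(** The tail of the resolution of N resolves its k-th syzygy K, so Tor_{i+k}(-, N) = Tor_i(-, K) for
    i > 0 holds by computation. *)
Definition fres_shift (R : comNzRingType) (N K : lmodType R) (G : fres N) k
    (p : {linear 'rV[R]_(rk G k) -> K}) (ps : forall z, exists u, z = p u)
    (pk : forall u, p u = 0 <-> exists w, u = w *m dmx G k) : fres K :=
  @Fres R K (fun i => rk G (i + k)) (fun i => dmx G (i + k)) p ps pk
    (fun i => @dmx_exact R N G (i + k)).

(** Injectivity modulo m puts a unit into the first row; it clears its column in the other rows, and
    the smaller matrix is again injective modulo m. *)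
Lemma left_inverse (R : comNzRingType) (m : set R) g g' (A : 'M[R]_(g, g')) :
  noetherian R -> local_ring m ->
  (forall u : 'rV_g, (forall j, m ((u *m A) 0 j)) -> forall j, m (u 0 j)) ->
  exists B, A *m B = 1%:M.
Proof.
move=> nR lR; elim: g A => [|g IH] A mA.
  by exists 0; apply/matrixP => -[].
have [A0 [A1 AE]] : exists (A0 : 'rV[R]_g') (A1 : 'M[R]_(g, g')), A = col_mx A0 A1.
  by exists (usubmx (A : 'M_(1 + g, g'))), (dsubmx (A : 'M_(1 + g, g'))); rewrite vsubmxK.
have mulA (a : 'rV[R]_1) (u : 'rV_g) : (row_mx a u : 'rV_g.+1) *m A = a *m A0 + u *m A1.
  by rewrite AE -[LHS]/((row_mx a u : 'rV_(1 + g)) *m col_mx A0 A1) mul_row_col.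
have [j0 nm] : exists j, ~ m (A0 0 j).
  apply: contrapT => H; apply: (max_ideal1 lR).
  have : m ((row_mx 1%:M 0 : 'rV_(1 + g)) 0 (lshift g (0 : 'I_1))).
    apply: (mA (row_mx 1%:M 0)) => j; rewrite mulA mul1mx mul0mx addr0.
    by apply: contrapT => nm; apply: H; exists j.
  by rewrite row_mxEl mxE eqxx.
have [y y1] := max_ideal_unit nR lR nm.
pose b0 : 'cV[R]_g' := y *: delta_mx j0 0.
have A0b0 : A0 *m b0 = 1%:M.
  apply/matrixP => i j; rewrite !ord1 -scalemxAr -colE !mxE eqxx.
  by rewrite y1.
pose c := A1 *m b0.
have [B' B'E] : exists B', (A1 - c *m A0) *m B' = 1%:M.
  apply: IH => u mu j.
  have : m ((row_mx (- (u *m c)) u : 'rV_(1 + g)) 0 (rshift 1 j)).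
    apply: (mA (row_mx (- (u *m c)) u)) => k.
    by rewrite mulA addrC mulNmx -mulmxA -mulmxBr; exact: mu.
  by rewrite row_mxEr.
(* B' is corrected so that A0 sends it to 0, and below b0 is corrected by B2 so that A1 sends it to
   0. *)
pose B2 := B' - b0 *m (A0 *m B').
have A0B2 : A0 *m B2 = 0 by rewrite /B2 mulmxBr (mulmxA A0 b0) A0b0 mul1mx subrr.
have A1B2 : A1 *m B2 = 1%:M.
  by rewrite /B2 mulmxBr (mulmxA A1 b0) -/c (mulmxA c) -mulmxBl.
have A0b2 : A0 *m (b0 - B2 *m c) = 1%:M.
  by rewrite mulmxBr (mulmxA A0 B2) A0B2 mul0mx subr0.
have A1b2 : A1 *m (b0 - B2 *m c) = 0.
  by rewrite mulmxBr (mulmxA A1 B2) A1B2 mul1mx subrr.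
exists (row_mx (b0 - B2 *m c) B2 : 'M_(g', 1 + g)); rewrite AE.
rewrite -[LHS]/(col_mx A0 A1 *m (row_mx (b0 - B2 *m c) B2 : 'M_(g', 1 + g))).
rewrite mul_col_row A0b2 A1b2 A0B2 A1B2.
by rewrite -[RHS]/(1%:M : 'M_(1 + g)) scalar_mx_block.
Qed.

(** * Tor-independent pairs under (ldep) *)

Section TorIndependent.
Variables (R : comNzRingType) (m : set R).
Hypotheses (nR : noetherian R) (lR : local_ring m).
Variables (F : fres (residue m)) (d : nat).
Local Notation dp := (dp F).
(** [embed] is the Gorenstein input; [tensor_dp] is (ldep) in terms of [dp], which spares a separate
    treatment of zero modules. *)
Hypotheses (dR : dp d R^o)
  (embed : forall X : lmodType R, fg X -> dp d X ->
    exists g (j : {linear X -> 'rV[R]_g}) (C : lmodType R) (q : {linear 'rV[R]_g -> C}),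
      [/\ ses j q, fg C & dp d C])
  (tensor_dp : forall (M N : lmodType R) (G : fres N) a b c,
    fg M -> fg N -> (forall i, tor0 G i M) -> dp a M -> dp b N ->
    (c + d <= a + b)%N -> dp c (tensor M N)).
Implicit Types A B C L M N W X : lmodType R.

Lemma dp_free n : dp d 'rV[R]_n.
Proof. by apply: dp_flat dR; exact: flatlike_rV. Qed.

Lemma tor0_free N (G : fres N) i n : tor0 G i 'rV[R]_n.
Proof. by apply: tor0_flat; exact: flatlike_rV. Qed.

Lemma tensor_ses A B C N (G : fres N) (i : {linear A -> B}) (p : {linear B -> C}) :
  ses i p -> tor0 G 0 C ->
  ses (tensor_map N i : {linear tensor A N -> tensor B N})
      (tensor_map N p : {linear tensor B N -> tensor C N}).
Proof.
move=> ip tC; have [_ ex ps] := ip; split.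
- exact: (tor0_inj ip tC).
- exact: (tensor_map_exact G ex ps).
- exact: (tensor_map_surj G ps).
Qed.

(** Modules of depth d embed in free ones, so a single x regular on R will serve for X, X ox N and E
    ox N. *)
Lemma ring_regular X x : fg X -> dp d X -> injective ( *:%R x : {linear R^o -> R^o}) ->
  injective ( *:%R x : {linear X -> X}).
Proof.
move=> fX dX xinj; have [g [j [C [q [[jinj _ _] _ _]]]]] := embed fX dX.
apply: lin_inj => u xu; apply: (lin_inj0 jinj); apply/rowP => k.
rewrite [RHS]mxE; apply: (lin_inj0 xinj); have := congr1 j xu.
by rewrite /= linearZ linear0 => /rowP/(_ k); rewrite !mxE.
Qed.

(* With x regular on R, E is the pushout of the inclusion j and of multiplication
   by x on X.  It is Tor-independent from N, hence E (x) N has depth d and x is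
   regular on it; but x kills the image in E (x) N of T = ker (j (x) N), because it
   factors there through j.  Hence that image vanishes and T = x T. *)
Lemma pushforward_tor0 X C N (G : fres N) g (j : {linear X -> 'rV[R]_g})
    (q : {linear 'rV[R]_g -> C}) :
  (0 < d)%N -> ses j q -> fg X -> dp d X -> fg C -> dp d C -> fg N -> dp d N ->
  (forall i, tor0 G i X) -> forall i, tor0 G i C.
Proof.
move=> d0 jq fX dX fC dC fN dN tX.
suff tC : tor0 G 0 C.
  by case=> // i; apply: (tor0_right jq); [exact: tor0_free|exact: tX].
apply: (inj_tor0 jq); first exact: tor0_free.
have fR : fg (R^o : lmodType R) by exact: noeth_fg (@noeth_ring R nR).
have [x mx xR] := dp1_regular nR lR fR (dp_le d0 dR).
have xp := coker_ses (ring_regular fX dX xR).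
have [E [a [b [c [e [s [t [bc ae st ab [sE taE tbE]]]]]]]]] := pushout xp jq.
have fE : fg E by exact: fg_ses ae fX fC.
have dE : dp d E by exact (dp_mid ae dX dC).
have [il [ilE ils]] := @prod_ses R X 'rV[R]_g.
have tP i : tor0 G i (X * 'rV[R]_g)%type.
  by apply: (tor0_mid ils); [exact: tX|exact: tor0_free].
have dXN : dp d (tensor X N) by apply: (tensor_dp fX fN tX dX dN).
have fXN : fg (tensor X N) by exact: fg_tensor.
have xXN := ring_regular fXN dXN xR.
have sfst z : tensor_map N (fst : {linear (X * 'rV[R]_g)%type -> X}) (tensor_map N s z) = x *: z.
  rewrite -tensor_map_comp -tensor_map_scale; apply: tensor_map_eq => u /=.
  by rewrite sE.
have ssnd z : tensor_map N (snd : {linear (X * 'rV[R]_g)%type -> 'rV[R]_g}) (tensor_map N s z)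
    = - tensor_map N j z.
  rewrite -tensor_map_comp -scaleN1r -tensor_map_scale -tensor_map_comp.
  by apply: tensor_map_eq => u /=; rewrite sE scaleN1r.
(* s followed by the first projection is multiplication by x, which is injective on X ox N; hence s
   ox N is injective and Tor_1(E, N) = 0. *)
have tE : forall i, tor0 G i E.
  case=> [|i]; last by apply: (tor0_right st); [exact: tP|exact: tX].
  apply: (inj_tor0 st); first exact: tP.
  apply: (lin_inj (i := tensor_map N s)) => z /= z0; apply: (lin_inj0 xXN).
  by rewrite /= -sfst z0 (linear0 (tensor_map N _)).
have dEN : dp d (tensor E N) by apply: (tensor_dp fE fN tE dE dN).
have fEN : fg (tensor E N) by exact: fg_tensor.
have xEN := ring_regular fEN dEN xR.
pose T : set (tensor X N) := [set z | tensor_map N j z = 0].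
have sT : submodule T.
  apply/submoduleP; split=> [|k u v /= u0 v0]; first exact: (linear0 (tensor_map N j)).
  by rewrite /T /= (linearP (tensor_map N j)) /= u0 v0 scaler0 addr0.
apply: (lin_inj (i := tensor_map N j)) => z.
apply: (nakayama_sub nR lR fXN sT) => {}z Tz.
have [_ tex tsurj] := st.
have az : tensor_map N a z = 0.
  apply: (lin_inj0 xEN); rewrite /= -tensor_map_scale -tensor_map_comp.
  transitivity (tensor_map N (b \o j : {linear X -> E}) z).
    by apply: tensor_map_eq => u; rewrite /= -ab linearZ.
  by rewrite tensor_map_comp Tz (linear0 (tensor_map N b)).
(* The image of z in (X x R^g) ox N dies in E ox N, so it comes from some u under s; the two
   components say that z = x u and that u lies in T. *)
have [|u uE] := (tensor_map_exact G tex tsurj (tensor_map N il z)).1.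
  rewrite -tensor_map_comp -[RHS]az; apply: tensor_map_eq => u /=.
  by rewrite ilE taE.
exists x, u; split=> //; last first.
  rewrite -sfst -uE -tensor_map_comp -[LHS](scale1r z) -tensor_map_scale.
  by apply: tensor_map_eq => v /=; rewrite ilE scale1r.
rewrite /T /= -[tensor_map N j u]opprK.
rewrite -ssnd -uE -tensor_map_comp [X in - X](_ : _ = 0) ?oppr0 //.
rewrite -(scale0r (tensor_map N j z)) -tensor_map_scale -tensor_map_comp.
by apply: tensor_map_eq => v /=; rewrite ilE scale0r.
Qed.

Section Syzygy.
Variables (N : lmodType R) (G : fres N).

Lemma syzygy_module k : fg N -> exists (K : lmodType R) (p : {linear 'rV[R]_(rk G k) -> K}),
  [/\ forall z, exists u, z = p u,
      forall u, p u = 0 <-> exists w, u = w *m dmx G k,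
      fg K & forall n, (n <= k)%N -> (n <= d)%N -> dp n K].
Proof.
move=> fN; elim: k => [|k [K [p [ps pk fK dK]]]].
  exists N, (aug G); split=> //; [exact: aug_surj|exact: aug_ker|].
  by case.
have kp := ker_ses ps; have [vinj kex _] := kp.
have [p' p'E] : exists p' : {linear 'rV[R]_(rk G k.+1) -> ker p},
    forall u, (val : ker p -> _) (p' u) = (mulmxr (dmx G k) : {linear _ -> _}) u.
  apply: (lin_lift (i := (val : ker p -> 'rV[R]_(rk G k)))) => // u.
  by apply/kex/pk; exists u.
have p's z : exists u, z = p' u.
  have [|w wE] := (pk (val z)).1; first exact/eqP/(valP z).
  by exists w; apply: val_inj; rewrite p'E.
exists (ker p), p'; split=> //.
- move=> u; rewrite -dmx_exact -[u *m _]/((mulmxr (dmx G k) : {linear _ -> _}) u) -p'E.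
  by split=> [->|/(lin_inj0 (i := (val : ker p -> _)) vinj)//]; rewrite linear0.
- by apply: fg_surj p's _; exact: fg_rV.
- case=> // n nk nd; apply: (dp_left kp); first by apply: dK => //; exact: ltnW.
  exact: dp_le nd (@dp_free _).
Qed.

Hypotheses (d0 : (0 < d)%N) (fN : fg N).

Lemma pushforward_tail X C g (j : {linear X -> 'rV[R]_g}) (q : {linear 'rV[R]_g -> C}) :
  ses j q -> fg X -> dp d X -> fg C -> dp d C ->
  (forall i, tor0 G (i + d) X) -> forall i, tor0 G (i + d) C.
Proof.
move=> jq fX dX fC dC tX; have [K [p [ps pk fK dK]]] := syzygy_module d fN.
exact: (pushforward_tor0 (G := fres_shift ps pk) d0 jq fX dX fC dC fK (dK d _ _) tX).
Qed.

(** X is the d-th syzygy of an iterated cokernel, so Tor_i(X, N) is Tor_{i+d} of that cokernel,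
    which vanishes by [pushforward_tail]. *)
Lemma tor0_tail X : fg X -> dp d X -> (forall i, tor0 G (i + d) X) -> forall i, tor0 G i X.
Proof.
move=> fX dX tX i; have : (d <= i + d)%N by exact: leq_addl.
(* k bounds the number of cokernels still to be taken. *)
move: {2}d => k; elim: k X i fX dX tX => [|k IH] X i fX dX tX.
  by rewrite addn0 => di; rewrite -(subnK di); exact: tX.
move=> di; have [g [j [C [q [jq fC dC]]]]] := embed fX dX.
have tC := pushforward_tail jq fX dX fC dC tX.
apply: (tor0_left jq); last exact: tor0_free.
by apply: IH => //; rewrite addSnnS.
Qed.

End Syzygy.

(** Dimension shifting yields Tor_i(C, N) = 0 only for i > 1; as d > 0 this covers the tail, from
    which [tor0_tail] recovers Tor_1. *)
Lemma pushforward_tor C X N (G : fres N) g (j : {linear X -> 'rV[R]_g})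
    (q : {linear 'rV[R]_g -> C}) :
  (0 < d)%N -> fg N -> ses j q -> fg X -> fg C -> dp d C ->
  (forall i, tor0 G i X) -> forall i, tor0 G i C.
Proof.
move=> d0 fN jq fX fC dC tX; apply: tor0_tail => // i.
rewrite -(prednK d0) addnS; apply: (tor0_right jq); first exact: tor0_free.
exact: tX.
Qed.

(** Take a nonzero class v in Ext^b(k, N). If f(u) has entries in m, then f(u) ox v is zero because
    m kills Ext(k, -). As f ox N is injective on Ext^b(k, -), so is u ox v, and with it each u_j v;
    hence no u_j is a unit. *)
Lemma free_minimal N (G : fres N) (P : lmodType R) g g' b (f : {linear 'rV[R]_g -> 'rV[R]_g'})
    (p : {linear 'rV[R]_g' -> P}) :
  ses f p -> tor0 G 0 P -> dp b (tensor P N) -> dp b N -> ~ dp b.+1 N ->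
  forall u, (forall j, m ((f u) 0 j)) -> forall j, m (u 0 j).
Proof.
move=> fp tP dPN dN ndN u mu j.
have [v v0 nv] : exists2 v : 'I_(krk F b.+1) -> N, mact (kmx F b.+1) v = 0 &
    ~ exists w, v = mact (kmx F b) w.
  apply: contrapT => H; apply: ndN => i; rewrite ltnS leq_eqVlt => /orP[/eqP ->|]; last exact: dN.
  by move=> v v0; apply: contrapT => nv; apply: H; exists v.
have /choice[w wE] : forall k, exists w, (f u) 0 k *: v = mact (kmx F b) w.
  by move=> k; exact: ext_kill.
have [|y yE] := coboundary_lift (F := F) (tensor_ses fp tP) (v := fun l => tens u (v l))
    (w := \sum_k (tensr (delta_mx 0 k) \o w k : _ -> tensor 'rV[R]_g' N)) dPN.
  transitivity (\sum_k (tensr (delta_mx 0 k) \o ((f u) 0 k *: v) : _ -> tensor 'rV[R]_g' N)).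
    apply/funext => l; rewrite fct_sumE /= tensor_mapE {1}[f u]row_sum_delta.
    rewrite -[LHS]/(tensl (v l) _) linear_sum; apply: eq_bigr => k _.
    by rewrite linearZ /= -tensZr.
  by rewrite linear_sum; apply: eq_bigr => k _; rewrite wE; exact: mact_map.
have [||h hE] := @tensor_lift R 'rV[R]_g N N (fun u n => u 0 j *: n).
- by move=> n k x x'; rewrite !mxE scalerDl scalerA.
- by move=> x k n n'; rewrite scalerDr !scalerA mulrC.
apply: contrapT => /(max_ideal_unit nR lR)[z zu]; apply: nv.
exists (z *: (h \o y)); rewrite linearZ /= -mact_map -yE; apply/funext => l.
transitivity (z *: h (tens u (v l))) => //.
by rewrite hE scalerA zu scale1r.
Qed.

(** E is a maximal Cohen-Macaulay approximation of M: the first syzygy of M has depth d and embeds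
    in R^g, and the pushout E along this embedding is also an extension of C by R^f, hence of depth
    d. *)
Lemma codepth1 M N (G : fres N) b : (0 < d)%N -> fg M -> fg N -> (forall i, tor0 G i M) ->
  dp d.-1 M -> dp b N -> ~ dp b.+1 N -> dp b (tensor M N) -> dp d M.
Proof.
move=> d0 fM fN tM dM dN ndN dMN.
have [f [p ps]] := (fg_rVP M).1 fM; have kp := ker_ses ps; have [vinj _ _] := kp.
have fL : fg (ker p) by apply: (fg_sub nR (i := (val : ker p -> _)) vinj); exact: fg_rV.
have dL : dp d (ker p).
  by rewrite -(prednK d0); apply: (dp_left kp dM); rewrite prednK //; exact: dp_free.
have [g [j [C [q [jq fC dC]]]]] := embed fL dL.
have [E [a [be [c [e [_ [_ [bc ae _ _ _]]]]]]]] := pushout kp jq.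
have fE : fg E by exact: fg_ses ae (fg_rV R f) fC.
have dE : dp d E by exact (dp_mid ae (@dp_free f) dC).
have tE i : tor0 G i E by apply: (tor0_mid bc); [exact: tor0_free|exact: tM].
have [g' [j' [C' [q' [jq' fC' dC']]]]] := embed fE dE.
have tC' := pushforward_tor d0 fN jq' fE fC' dC' tE.
have [P [cP [u [v [bP uv]]]]] := ses_comp bc jq'.
have tP i : tor0 G i P by apply: (tor0_mid uv); [exact: tM|exact: tC'].
have dPN : dp b (tensor P N).
  apply (dp_mid (tensor_ses uv (tC' 0%N)) dMN).
  by apply: (tensor_dp fC' fN tC' dC' dN); rewrite addnC.
have fmin := free_minimal bP (tP 0%N) dPN dN ndN.
have [|B AB] := @left_inverse R m g g' (lin1_mx (j' \o be)) nR lR.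
  by move=> w mw; apply: fmin => k; rewrite -mul_rV_lin1.
have rE w : j' (be w) *m B = w.
  by rewrite -[j' (be w)](mul_rV_lin1 (j' \o be : {linear _ -> _})) -mulmxA AB mulmx1.
have [_ cex cs] := bc.
(* The identity minus x |-> be (j' x *m B) kills the image of [be], so it descends to a section of
   c. *)
have [s sE] : exists s : {linear M -> E}, forall x,
    s (c x) = (idfun \- (be \o (mulmxr B \o j'))) x.
  by apply: lin_factor => // x /cex[w ->]; rewrite /= rE subrr.
apply: (dp_retract (i := s) (p := c)) dE => y; have [x ->] := cs y.
by rewrite sE /= linearB (ses_comp0 _ bc) subr0.
Qed.

Lemma no_excess M N (G : fres N) a b c : fg M -> fg N -> (forall i, tor0 G i M) ->
  dp a M -> ~ dp a.+1 M -> (a < d)%N -> dp b N -> ~ dp b.+1 N -> dp c (tensor M N) ->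
  (a + b < c + d)%N -> False.
Proof.
move=> fM fN tM dM ndM ad dN ndN dMN lt.
(* k is the number of syzygies to take until the depth is d - 1. *)
have [k kE] : exists k, (k + a.+1 = d)%N by exists (d - a.+1)%N; rewrite subnK.
elim: k M a c fM tM dM ndM ad dMN lt kE => [|k IH] M a c fM tM dM ndM ad dMN lt kE.
  apply: ndM; rewrite [a.+1]kE; apply: (codepth1 _ fM fN tM _ dN ndN).
  - by rewrite -kE.
  - by rewrite -kE.
  - by apply: dp_le dMN; move: lt; rewrite -kE add0n addnS ltnS addnC leq_add2r.
have [f [p ps]] := (fg_rVP M).1 fM; have kp := ker_ses ps; have [vinj _ _] := kp.
have ad1 : (a.+1 < d)%N by rewrite -kE addSn ltnS leq_addl.
(* For c < b the syzygy gains one unit of depth after tensoring; otherwise only b, from R^f ox N, is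
   available, and a + 1 < d keeps the excess. *)
apply: (IH (ker p) a.+1 (if (c < b)%N then c.+1 else b)) => //.
- by apply: (fg_sub nR (i := (val : ker p -> _)) vinj); exact: fg_rV.
- by move=> i; apply: (tor0_left kp); [exact: tM|exact: tor0_free].
- apply (dp_left kp dM); exact: dp_le ad (@dp_free f).
- move=> dK; apply: ndM; apply (dp_right kp); last exact: dK.
  exact: dp_le ad (@dp_free f).
- have tkp := tensor_ses kp (tM 0%N).
  have dFN : dp b (tensor 'rV[R]_f N).
    apply: (tensor_dp (fg_rV R f) fN (fun i => @tor0_free N G i f) (@dp_free f) dN).
    by rewrite addnC.
  case: ifPn => [cb|]; first exact (dp_left tkp dMN (dp_le cb dFN)).
  by rewrite -leqNgt => bc; exact (dp_left' tkp (dp_le bc dMN) dFN).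
- by case: ifP => _; [rewrite !addSn ltnS|rewrite addnC ltn_add2l].
- by rewrite -kE addSnnS.
Qed.

End TorIndependent.

(** * From (ldep) to (rdep) *)

Lemma dp_level (R : comNzRingType) (m : set R) (F : fres (residue m)) d (X : lmodType R) :
  (forall X : lmodType R, fg X -> dp F d.+1 X -> forall x : X, x = 0) ->
  fg X -> nonzero X -> exists a, [/\ (a <= d)%N, dp F a X & ~ dp F a.+1 X].
Proof.
move=> small fX [x x0].
have : ~ dp F d.+1 X by move=> dX; case/eqP: x0; exact: small.
elim: d {small} => [|k IH] ndX; first by exists 0%N.
have [dX|/IH[a [ak dX nd]]] := pselect (dp F k.+1 X); first by exists k.+1.
by exists a; split=> //; exact: leqW.
Qed.

Lemma nonzero_tensor (R : comNzRingType) (M N : lmodType R) (G : fres N) :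
  nonzero (tensor M N) -> nonzero M /\ nonzero N.
Proof.
move=> [z /eqP z0]; split; apply: contrapT => nz; apply: z0;
  move: z; apply: tensorind => [|x y];
  try by apply/submoduleP; split=> // a u v -> ->; rewrite scaler0 addr0.
- rewrite (_ : x = 0); first exact: (linear0 (tensl y)).
  by apply: contrapT => x0; apply: nz; exists x; apply/eqP.
- rewrite (_ : y = 0); first exact: (linear0 (tensr x)).
  by apply: contrapT => y0; apply: nz; exists y; apply/eqP.
Qed.

Theorem corollary4p7 (R : comNzRingType) (m : set R)
    (gorR : gorenstein_local m) :
  ldep m -> rdep m.
Proof.
have [nR lR _] := gorR.
have [F] := fres_exists nR (fg_residue m nR).
have [d [dR ndR embed small]] := gorenstein_depth F gorR.
have fR : fg (R^o : lmodType R) by exact: noeth_fg (@noeth_ring R nR).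
have depthR : depth m (R^o : lmodType R) = (d%:Z)%:E%E.
  by apply: (depthE nR lR fR _ dR ndR); exists 1; exact: oner_neq0.
have level X := @dp_level R m F d X small.
move=> lR'; have tensor_dp (M N : lmodType R) (G : fres N) a b c :
    fg M -> fg N -> (forall i, tor0 G i M) -> dp F a M -> dp F b N ->
    (c + d <= a + b)%N -> dp F c (tensor M N).
  move=> fM fN tM dM dN cab.
  (* If M ox N = 0, then [q_Tor] is -oo and (ldep) does not apply, but every [dp] holds. *)
  have [nzT|zT] := pselect (nonzero (tensor M N)); last first.
    by apply: dp_zero => z; apply: contrapT => z0; apply: zT; exists z; apply/eqP.
  have [nzM nzN] := nonzero_tensor G nzT.
  have [a' [_ dM' ndM']] := level M fM nzM.
  have [b' [_ dN' ndN']] := level N fN nzN.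
  have [c' [_ dT' ndT']] := level _ (fg_tensor G fM) nzT.
  have q0 : q_Tor M N = 0%E by apply/(q_TorP G).
  have := lR' M N ((fgP M).1 fM) ((fgP N).1 fN) q0.
  rewrite (depthE nR lR fM nzM dM' ndM') (depthE nR lR fN nzN dN' ndN').
  rewrite (depthE nR lR (fg_tensor G fM) nzT dT' ndT') depthR -!EFinD lee_fin.
  rewrite -!PoszD lez_nat.
  have aa' : (a <= a')%N by rewrite leqNgt; apply/negP => /dp_le/(_ dM)/ndM'.
  have bb' : (b <= b')%N by rewrite leqNgt; apply/negP => /dp_le/(_ dN)/ndN'.
  move=> abc; apply: dp_le dT'; rewrite -(leq_add2r d).
  by apply: leq_trans cab _; apply: leq_trans abc; exact: leq_add.
move=> M N /fgP fM /fgP fN q0.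
have [G] := fres_exists nR fN; have [H] := fres_exists nR fM.
have [tM nzT] := (q_TorP G M).1 q0; have [nzM nzN] := nonzero_tensor G nzT.
have [a [ad dM ndM]] := level M fM nzM.
have [b [bd dN ndN]] := level N fN nzN.
have [c [cd dT ndT]] := level _ (fg_tensor G fM) nzT.
rewrite (depthE nR lR fM nzM dM ndM) (depthE nR lR fN nzN dN ndN).
rewrite (depthE nR lR (fg_tensor G fM) nzT dT ndT) depthR -!EFinD lee_fin.
rewrite -!PoszD lez_nat leqNgt; apply/negP => lt.
have [ltad|dle] := ltnP a d.
  exact: (no_excess nR lR dR embed tensor_dp fM fN tM dM ndM ltad dN ndN dT lt).
(* If both depths are at least d, the excess would require c > d; for d = 0 only this case
   occurs. *)
have [ltbd|dle'] := ltnP b d; last first.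
  by move: lt; rewrite ltnNge leq_add // (leq_trans cd).
have [f [g [fgK gfK]]] := tensor_comm M N.
have dT' : dp F c (tensor N M) by exact: dp_retract gfK dT.
apply: (no_excess nR lR dR embed tensor_dp fN fM (tor0_swap (H := H) tM) dN ndN ltbd dM ndM dT').
by rewrite addnC.
Qed.
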